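(* Fix $\alpha\in(0,1)$ and let $(P_i)_{i\ge0}$ be the $\alpha$-random walk in $\mathbb{Z}^2$. For $i\ge1$ let $X_i=1$ if $P_i$ is visible and $X_i=0$ otherwise, and put $\overline S_n=\frac{X_1+\cdots+X_n}{n}$. Then $$\lim_{n\to\infty}\overline S_n=\frac{6}{\pi^2}\quad\text{almost surely.}$$
   Context: The $\alpha$-random walk is defined by $P_0=(0,0)$ and, for $i\ge0$, $P_{i+1}=P_i+(1,0)$ with probability $\alpha$ and $P_{i+1}=P_i+(0,1)$ with probability $1-\alpha$, the steps being independent. A lattice point $(a,b)$ is called visible (from the origin) if $\gcd(a,b)=1$. *)

(* Defs.v *)
From HB Require Import structures.
From mathcomp Require Import all_boot all_order all_algebra.
From mathcomp Require Import all_classical all_reals all_analysis.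
Set Implicit Arguments. Unset Strict Implicit. Unset Printing Implicit Defensive.
Import Order.TTheory GRing.Theory Num.Theory.
Local Open Scope classical_set_scope.
Local Open Scope ring_scope.

Definition mutually_independent {d} {T : measurableType d} {R : realType}
  (P : probability T R) (E : nat -> set T) : Prop :=
  forall F : seq nat, uniq F ->
    P (\bigcap_(i in [set j | j \in F]) E i) = (\prod_(i <- F) P (E i))%E.

(* The alpha-random walk is driven by the events E i = "step i+1 is (1,0)".
   First coordinate of P_n = number of j < n such that E j occurred. *)
Definition walk_x {T : Type} (E : nat -> set T) (n : nat) (w : T) : nat :=
  \sum_(j < n) (w \in E j : nat).

Definition walk_y {T : Type} (E : nat -> set T) (n : nat) (w : T) : nat :=
  n - walk_x E n w.

Definition visible (a b : nat) : bool := gcdn a b == 1.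

Definition Xvis {T : Type} (E : nat -> set T) (i : nat) (w : T) : nat :=
  visible (walk_x E i w) (walk_y E i w).

Definition Sbar {R : realType} {T : Type} (E : nat -> set T) (n : nat) (w : T) : R :=
  (\sum_(1 <= i < n.+1) (Xvis E i w)%:R) / n%:R.

(* Main.v *)
(* Since P_i = (S_i, i - S_i), the point P_i is visible iff gcd(S_i, i) = 1, so Moebius inversion
   gives X_1 + ... + X_n = sum_(q <= n) mu(q) N_q(n), where N_q(n) counts the m <= n / q such that
   q divides S_(q m). The total variation of the binomial weights is O(k^(-1/2)), so S_k is
   divisible by q with probability 1/q + O(k^(-1/2)) uniformly in q. For small q this and the
   renewal structure give N_q(n) = n / q^2 + O(n^(3/4)) in mean square; for large q it bounds the
   mean of N_q(n). Taking n = k^16 and calling q small when q <= k^2, the mean total error is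
   O(k^-2), hence the error tends to 0 almost surely along n = k^16, and the averages vary little
   between consecutive such n. The limit is sum_q mu(q) / q^2 = 1 / zeta(2), and zeta(2) = pi^2 / 6
   follows from 1 / sin^2 x - 1 <= 1 / x^2 <= 1 / sin^2 x summed over (2k+1) pi / 2^(n+2). *)
Require Import Defs.
From HB Require Import structures.
From mathcomp Require Import all_boot all_order all_algebra.
From mathcomp Require Import all_classical all_reals all_analysis.
From mathcomp Require Import measurable_realfun ring lra zify.
Import Order.TTheory GRing.Theory Num.Theory numFieldNormedType.Exports.
Local Open Scope classical_set_scope.
Local Open Scope ring_scope.

Set Implicit Arguments.
Unset Strict Implicit.

(** * Möbius function and divisor sums *)

Lemma sum_multiples (V : nmodType) (F : nat -> V) (d N : nat) : (0 < d)%N ->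
  \sum_(1 <= e < N.+1 | (d %| e)%N) F e =
  \sum_(1 <= m < (N %/ d).+1) F (d * m)%N.
Proof.
move=> d0; elim: N => [|N IH]; first by rewrite div0n !big_geq.
rewrite big_mkcond big_nat_recr //= -big_mkcond IH divnS //.
case: ifPn => [dN|_]; last by rewrite add0n addr0.
rewrite add1n [RHS]big_nat_recr //=; congr (_ + F _).
have := divnK dN; rewrite divnS // dN add1n => <-; exact: mulnC.
Qed.

(** Since [primes 0] is empty, the value at 0 defaults to 1; all sums below start at 1. *)
Definition mobius {R : pzRingType} (n : nat) : R :=
  \prod_(q <- primes n) (if logn q n == 1%N then -1 else 0).

Lemma mobius1 (R : pzRingType) : mobius 1 = 1 :> R.
Proof. by rewrite /mobius big_nil. Qed.

(** The only case of multiplicativity that [sum_mobius] needs. If [p] divides [e], its exponent in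
    [p * e] is at least 2 and kills the product; otherwise [p] brings one new factor -1. *)
Lemma mobius_prime_mul (R : comPzRingType) (p e : nat) : prime p -> (0 < e)%N ->
  mobius (p * e) = if (p %| e)%N then 0 else - mobius e :> R.
Proof.
move=> pp e0; have p0 := prime_gt0 pp.
have pe0 : (0 < p * e)%N by rewrite muln_gt0 p0.
case: ifPn => pe.
  have pin : p \in primes (p * e) by rewrite mem_primes pp pe0 dvdn_mulr.
  rewrite /mobius (bigD1_seq p) ?primes_uniq //= lognM // lognE pp p0 dvdnn /=.
  by rewrite divnn p0 logn1 lognE pp e0 pe /= mul0r.
have pr : perm_eq (primes (p * e)) (p :: primes e).
  apply: uniq_perm; rewrite /= ?primes_uniq ?mem_primes ?pp ?e0 ?(negbTE pe) //.
  by move=> q; rewrite primesM // primes_prime // !inE.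
rewrite /mobius (perm_big _ pr) big_cons lognM // (lognE p p) pp p0 dvdnn /=.
rewrite divnn p0 logn1 (lognE p e) pp e0 (negbTE pe) /= mulN1r; congr (- _).
apply: eq_big_seq => q; rewrite mem_primes => /and3P[qp _ qe].
rewrite lognM // [logn q p]lognE qp p0 /= dvdn_prime2 //.
by case: (q =P p) => // qEp; rewrite -qEp qe in pe.
Qed.

Lemma normr_mobius (R : numDomainType) n : `|mobius n : R| <= 1.
Proof.
rewrite /mobius normr_prod.
(* Nonnegativity is carried along because the upper bound passes to products only with it. *)
have H : 0 <= \prod_(q <- primes n) `|if logn q n == 1%N then -1 else 0 : R| <= 1.
  elim/big_ind : _ => [|x y /andP[x0 x1] /andP[y0 y1]|q _].
  - by rewrite ler01 lexx.
  - by rewrite mulr_ge0 // mulr_ile1.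
  - by case: ifP; rewrite ?normrN ?normr1 ?normr0 ?lexx ?ler01.
by case/andP: H.
Qed.

(** Fix a prime factor [p] of [n > 1]. The divisors [p * m] contribute [- mobius m] when [p] does
    not divide [m] and 0 otherwise, which cancels the divisors prime to [p]. *)
Lemma sum_mobius (R : comPzRingType) n : (0 < n)%N ->
  \sum_(1 <= d < n.+1 | (d %| n)%N) mobius d = (n == 1)%N%:R :> R.
Proof.
move=> n0; have [->|n1] := eqVneq n 1%N; first by rewrite big_mkcond big_nat1 dvdnn mobius1.
have {n1} n1 : (1 < n)%N by case: n n0 n1 => [|[|]].
set p := pdiv n; have pp : prime p := pdiv_prime n1.
have pn : (p %| n)%N := pdiv_dvd n.
rewrite (bigID (fun d => p %| d)%N) /=.
under eq_bigl do rewrite andbC.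
rewrite big_mkcondr /= sum_multiples ?prime_gt0 //.
have -> : \sum_(1 <= m < (n %/ p).+1)
      (if (p * m %| n)%N then mobius (p * m) else 0) =
    - \sum_(1 <= m < (n %/ p).+1 | (p * m %| n)%N && ~~ (p %| m)%N) mobius m :> R.
  rewrite big_mkcondr [in RHS]big_mkcond -sumrN /=.
  apply: eq_big_nat => m /andP[m0 _]; case: ifP => _; last by rewrite oppr0.
  by rewrite mobius_prime_mul //; case: ifP; rewrite ?oppr0.
apply/eqP; rewrite addrC subr_eq0; apply/eqP.
(* A divisor of [n] prime to [p] divides [n %/ p], so both sums run over the same [m]. *)
rewrite [RHS](big_nat_widen _ _ n.+1) ?ltnS ?leq_div //.
rewrite [LHS]big_nat_cond [RHS]big_nat_cond; apply: eq_bigl => m.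
case: (boolP (0 < m)%N) => m0 //=; case: (m < n.+1)%N => //=.
case: (boolP (p %| m)%N) => pm; rewrite ?andbF //= !andbT.
have cop : coprime p m by rewrite prime_coprime.
apply/idP/andP => [mn|[pmn _]]; last exact: dvdn_trans (dvdn_mull _ _) pmn.
by rewrite Gauss_dvd // pn mn ltnS leq_divRL ?prime_gt0 // mulnC dvdn_leq // Gauss_dvd // pn.
Qed.

(** * Elementary sums and partial sums of zeta(2) *)

(** Telescoping: consecutive roots satisfy [b ^+ 2 - a ^+ 2 = 1] and [a <= b], hence
    [b^-1 <= 2 * (b - a)]. *)
Lemma sum_inv_sqrt (R : rcfType) (N : nat) :
  \sum_(1 <= m < N.+1) (Num.sqrt m%:R)^-1 <= 2 * Num.sqrt N%:R :> R.
Proof.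
elim: N => [|N IH]; first by rewrite big_geq // sqrtr0 mulr0.
rewrite big_nat_recr //=; set a := Num.sqrt N%:R in IH *.
set b := Num.sqrt N.+1%:R.
have b0 : 0 < b by rewrite sqrtr_gt0 ltr0n.
have a0 : 0 <= a by rewrite sqrtr_ge0.
have ab : b ^+ 2 = a ^+ 2 + 1 by rewrite !sqr_sqrtr ?ler0n // natr1.
have le_ab : a <= b by rewrite ler_wsqrtr // ler_nat.
have : b^-1 <= 2 * (b - a).
  rewrite -[leLHS]div1r ler_pdivrMr //; nra.
lra.
Qed.

(** Telescoping again: ln(1 + x) <= x at x = -1/(N+2) bounds the new term by a difference of
    logarithms. *)
Lemma harmonic_le_ln (R : realType) (N : nat) : (0 < N)%N ->
  \sum_(1 <= m < N.+1) m%:R^-1 <= 1 + ln N%:R :> R.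
Proof.
case: N => // N _; elim: N => [|N IH]; first by rewrite big_nat1 invr1 ln1 addr0.
rewrite big_nat_recr //=.
suff : N.+2%:R^-1 <= ln N.+2%:R - ln N.+1%:R :> R.
  by rewrite lerBrDr => h; apply: le_trans (lerD IH (lexx _)) _; rewrite -addrA lerD2l addrC.
rewrite -ln_div ?posrE ?ltr0n // -[leRHS]opprK -lnV ?posrE ?divr_gt0 ?ltr0n //.
rewrite lerNr invf_div.
have -> : N.+1%:R / N.+2%:R = 1 + - (N.+2%:R)^-1 :> R.
  have : 0 < N.+1%:R :> R by rewrite ltr0n.
  rewrite -[N.+2%:R]natr1; move: (N.+1%:R : R) => x x0.
  by field; rewrite gt_eqF // addr_gt0.
by apply: le_ln1Dx; rewrite ltrN2 invf_lt1 ?ltr0n // ltr1n.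
Qed.

Definition zeta2 {R : unitRingType} (N : nat) : R := \sum_(1 <= m < N.+1) m%:R^-2.

Lemma zeta2_mono (R : numFieldType) M N : (M <= N)%N -> zeta2 M <= zeta2 N :> R.
Proof.
move=> MN; rewrite /zeta2 [leRHS](big_cat_nat (n := M.+1)) //= lerDl.
by apply: sumr_ge0 => i _; rewrite invr_ge0 exprn_ge0 ?ler0n.
Qed.

Lemma zeta2_tail (R : realFieldType) M N : (0 < M <= N)%N ->
  zeta2 N <= zeta2 M + M%:R^-1 :> R.
Proof.
(* The extra [- N%:R^-1] makes the induction close, as 1/(N+1)^2 <= 1/N - 1/(N+1). *)
case/andP=> M0 MN; suff : zeta2 N <= zeta2 M + M%:R^-1 - N%:R^-1 :> R.
  by move=> /le_trans; apply; rewrite gerBl invr_ge0 ler0n.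
elim: N MN => [|N IH]; first by rewrite leqn0 => /eqP h; rewrite h in M0.
rewrite leq_eqVlt => /predU1P[->|]; first by rewrite addrK.
rewrite ltnS => MN; have := IH MN; rewrite {3}/zeta2 big_nat_recr //= -/(zeta2 N).
have N0 : 0 < N%:R :> R by rewrite ltr0n (leq_trans M0).
have : (N.+1%:R)^-2 <= N%:R^-1 - N.+1%:R^-1 :> R.
  rewrite -[N.+1%:R]natr1.
  have -> : N%:R^-1 - (N%:R + 1)^-1 = (N%:R * (N%:R + 1))^-1 :> R.
    by field; rewrite (gt_eqF N0) andbT gt_eqF // addr_gt0.
  by rewrite lef_pV2 ?posrE ?mulr_gt0 ?exprn_gt0 //; nra.
move: (zeta2 N) (zeta2 M) (N.+1%:R^-1) (N.+1%:R^-2) => z z' u v; lra.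
Qed.

Lemma zeta2_le2 (R : realFieldType) N : zeta2 N <= 2 :> R.
Proof.
case: N => [|N]; first by rewrite /zeta2 big_geq.
by have := @zeta2_tail R 1 N.+1 isT; rewrite {2}/zeta2 big_nat1 expr1n invr1.
Qed.

(** Cutting the inner sum at [N %/ d] keeps exactly the pairs with product [e = d * m <= N].
    Collected by [e], they give the divisor sum of [mobius] over [e ^+ 2], which vanishes unless
    [e = 1]. *)
Lemma sum_mobius_zeta2 (R : realFieldType) N : (0 < N)%N ->
  \sum_(1 <= d < N.+1) mobius d / d%:R ^+ 2 * zeta2 (N %/ d) = 1 :> R.
Proof.
move=> N0.
transitivity (\sum_(1 <= d < N.+1) \sum_(1 <= e < N.+1 | (d %| e)%N)
    mobius d * e%:R^-2 : R).
  apply: eq_big_nat => d /andP[d0 _].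
  rewrite (sum_multiples _ N d0) /zeta2 mulr_sumr; apply: eq_bigr => m _.
  by rewrite -[LHS]mulrA -invfM -exprMn -natrM.
rewrite (exchange_big_dep_nat xpredT) //=.
transitivity (\sum_(1 <= e < N.+1) (e == 1)%N%:R / e%:R ^+ 2 : R).
  apply: eq_big_nat => e /andP[e0 eN]; rewrite -mulr_suml; congr (_ / _).
  rewrite -(sum_mobius R e0) [RHS](big_nat_widen _ _ N.+1) //.
  rewrite [LHS]big_nat_cond [RHS]big_nat_cond; apply: eq_bigl => d.
  case: (boolP (d %| e)%N) => //= de.
  by have -> : (d < e.+1)%N by exact: dvdn_leq e0 de.
rewrite big_ltn // eqxx expr1n divr1 big_nat_cond big1 ?addr0 // => e.
by rewrite andbT => /andP[e1 _]; rewrite gtn_eqF // mul0r.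
Qed.

(** * The value of zeta(2) *)

Lemma sin_lt_id (R : realType) (x : R) : 0 < x -> sin x < x.
Proof.
move=> x0; have [x1|x1] := ltP 1 x; first exact: le_lt_trans (sin_le1 x) x1.
have [c] := @MVT R sin cos 0 x x0 (fun y _ => is_derive_sin y) 
  (continuous_subspaceT (@continuous_sin R)).
rewrite in_itv /= sin0 !subr0 => /andP[c0 cx] ->.
rewrite gtr_pMl // lt_neqAle cos_le1 andbT; apply/negP => /eqP h.
have : sin c = 0 by apply: cos1sin0; rewrite h normr1.
apply/eqP; rewrite gt_eqF // sin2_gt0 // c0 /=; lra.
Qed.

Lemma id_lt_tan (R : realType) (x : R) : 0 < x < pi / 2 -> x < tan x.
Proof.
case/andP=> x0 xpi.
have cos_gt0 y : 0 <= y <= x -> 0 < cos y.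
  case/andP=> y0 yx; apply: cos_gt0_pihalf; apply/andP; split; last lra.
  by apply: lt_le_trans y0; rewrite oppr_lt0 divr_gt0 ?pi_gt0.
have [||c] := @MVT R tan (fun y => (cos y)^-2) 0 x x0.
- move=> y; rewrite in_itv /= => /andP[y0 yx]; apply: is_derive_tan.
  by rewrite gt_eqF // cos_gt0 // !ltW.
- apply/continuous_in_subspaceT => y; rewrite inE /= in_itv /= => yx.
  by apply: continuous_tan; rewrite gt_eqF // cos_gt0.
rewrite in_itv /= tan0 !subr0 => /andP[c0 cx] ->.
rewrite ltr_pMl // invf_gt1 ?exprn_gt0 ?cos_gt0 ?ltW //.
have := cos2Dsin2 c; have : 0 < sin c by apply: sin_gt0_pihalf; rewrite c0 /=; lra.
nra.
Qed.

(** This is sin x < x < tan x, squared and inverted, with 1/tan^2 = 1/sin^2 - 1. *)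
Lemma inv_sqr_sin_bounds (R : realType) (x : R) : 0 < x < pi / 2 ->
  (sin x)^-2 - 1 <= x^-2 <= (sin x)^-2.
Proof.
move=> xpi; have /andP[x0 xlt] := xpi.
have s0 : 0 < sin x by exact: sin_gt0_pihalf.
have c0 : 0 < cos x.
  by apply: cos_gt0_pihalf; rewrite xlt (lt_trans _ x0) // oppr_lt0 divr_gt0 ?pi_gt0.
have := sin_lt_id x0; have := id_lt_tan xpi; rewrite /tan ltr_pdivlMr // => h1 h2.
apply/andP; split; last first.
  by rewrite lef_pV2 ?posrE ?exprn_gt0 // lerXn2r ?nnegrE ?ltW.
have -> : (sin x)^-2 - 1 = (sin x / cos x)^-2.
  by rewrite exprMn exprVn invf_div cos2sin2; field; rewrite gt_eqF.
have h : x < sin x / cos x by rewrite ltr_pdivlMr.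
by rewrite lef_pV2 ?posrE ?exprn_gt0 ?divr_gt0 // lerXn2r ?nnegrE ?divr_ge0 ?ltW.
Qed.

(** The midpoint of the [k]-th of [M] equal pieces of the interval from 0 to pi / 2. *)
Definition basel_node (R : realType) (M k : nat) : R := pi * (2 * k + 1)%N%:R / (4 * M)%N%:R.

Lemma basel_node_itv (R : realType) M k : (k < M)%N -> 0 < basel_node R M k < pi / 2.
Proof.
move=> kM; have M0 : (0 < M)%N by exact: leq_ltn_trans kM.
have pi0 := pi_gt0 R; rewrite /basel_node divr_gt0 ?mulr_gt0 ?ltr0n ?addn1 ?muln_gt0 ?M0 //=.
rewrite ltr_pdivrMr ?ltr0n ?muln_gt0 ?M0 // -mulrA ltr_pM2l // natrM.
have -> : 2^-1 * (4%:R * M%:R) = (2 * M)%N%:R :> R by rewrite natrM; field.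
by rewrite ltr_nat; lia.
Qed.

(** The second sine is cos(x/2), and 1/s^2 + 1/c^2 = 1/(s c)^2 when s^2 + c^2 = 1, while sin x = 2 s
    c. *)
Lemma csc2_double (R : realType) (x : R) : 0 < x < pi / 2 ->
  4 * (sin x)^-2 = (sin (x / 2))^-2 + (sin ((pi - x) / 2))^-2.
Proof.
case/andP=> x0 xpi.
have -> : sin ((pi - x) / 2) = cos (x / 2).
  by rewrite mulrBl sinB sin_pihalf cos_pihalf mul1r mul0r subr0.
have s0 : 0 < sin (x / 2) by apply: sin_gt0_pihalf; lra.
have c0 : 0 < cos (x / 2) by apply: cos_gt0_pihalf; lra.
have -> : sin x = 2 * (cos (x / 2) * sin (x / 2)).
  by rewrite -[in LHS](@divfK _ 2 _ x) // mulr_natr sin_mulr2n mulr_natl.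
have := cos2Dsin2 (x / 2); move: s0 c0; set s := sin _; set c := cos _ => s0 c0 sc.
have -> : s^-2 + c^-2 = (c ^+ 2 + s ^+ 2) / (c * s) ^+ 2.
  by field; rewrite !gt_eqF.
by rewrite sc; field; rewrite !gt_eqF.
Qed.

(* Doubling: x / 2 and (pi - x) / 2 run over the nodes of order 2 M as x runs over those of order M. *)
Lemma csc2_sum (R : realType) n : \sum_(0 <= k < 2 ^ n) (sin (basel_node R (2 ^ n) k))^-2 = 2 * 4 ^+ n :> R.
Proof.
elim: n => [|n IH].
  (* The only node is pi / 4, where sine and cosine agree. *)
  rewrite expn0 expr0 mulr1 big_nat1 /basel_node muln0 add0n muln1 mulr1.
  have := cos2Dsin2 (pi / 4 : R); have := tan_piquarter R; rewrite /tan.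
  have c0 : 0 < cos (pi / 4) :> R by apply: cos_gt0_pihalf; have := pi_gt0 R; lra.
  move/divr1_eq => ->; rewrite -mulr2n -mulr_natl => h.
  apply: (mulfI (_ : cos (pi / 4) ^+ 2 != 0)); first by rewrite expf_neq0 ?gt_eqF.
  move: h; rewrite ?(muln1, mulr1) => h; rewrite mulfV ?expf_neq0 ?gt_eqF //.
  by rewrite mulr_natr h.
rewrite exprS mulrCA -IH mulr_sumr expnS; set M := (2 ^ n)%N.
have split_sum (F : nat -> R) :
    \sum_(0 <= k < 2 * M) F k = \sum_(0 <= k < M) F k + \sum_(0 <= k < M) F (k + M)%N.
  rewrite mul2n -addnn (big_cat_nat (n := M)) ?leq_addr //=; congr (_ + _).
  by rewrite -{1}[M]add0n big_addn addnK.
rewrite split_sum.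
(* Reversing the upper half puts the node (pi - x) / 2 at the same index as x / 2. *)
rewrite [X in _ + X]big_nat_rev add0n -big_split /=.
apply: eq_big_nat => k /andP[_ kM].
have M0 : (0 < M)%N by exact: leq_ltn_trans kM.
have M0' : M%:R != 0 :> R by rewrite pnatr_eq0 -lt0n.
rewrite csc2_double ?basel_node_itv //; congr (sin _ ^-2 + sin _ ^-2).
  by rewrite /basel_node !natrM; field.
rewrite /basel_node (_ : (2 * (M - k.+1 + M) + 1)%N%:R = 4 * M%:R - (2 * k + 1)%:R :> R).
  by rewrite !natrM; field.
by apply/eqP; rewrite -subr_eq opprK -!natrM -natrD; apply/eqP; congr _%:R; lia.
Qed.

Definition odd_zeta2 (R : realType) (M : nat) : R := \sum_(0 <= k < M) (2 * k + 1)%N%:R^-2.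

(** Up to the factor pi^2 / (16 M^2) this is the sum of the inverse squares of the nodes. [csc2_sum]
    bounds it above by pi^2 / 8, and losing 1 at each of the [M] nodes costs only pi^2 / (16 M). *)
Lemma cvg_odd_zeta2 (R : realType) : (fun n => odd_zeta2 R (2 ^ n)) @ \oo --> (pi ^+ 2 / 8 : R).
Proof.
have pi0 := pi_gt0 R.
have H n : pi ^+ 2 / 8 - pi ^+ 2 / 16 * (2^-1) ^+ n <= odd_zeta2 R (2 ^ n) <= pi ^+ 2 / 8.
  set M := (2 ^ n)%N; have M0 : 0 < M%:R :> R by rewrite ltr0n expn_gt0.
  have E1 : odd_zeta2 R M = pi ^+ 2 / (16 * M%:R ^+ 2) * \sum_(0 <= k < M) (basel_node R M k)^-2.
    rewrite /odd_zeta2 mulr_sumr; apply: eq_bigr => k _.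
    have k0 : 0 < (2 * k + 1)%:R :> R by rewrite addn1 ltr0n.
    rewrite /basel_node natrM; move: k0 pi0; move: (_%:R : R) (pi : R) => c p c0 p0; field.
    by rewrite !gt_eqF.
  have M4 : M%:R ^+ 2 = 4 ^+ n :> R.
    by rewrite natrX -exprM mulnC exprM; congr (_ ^+ n); rewrite -natrX.
  have c0 : 0 < pi ^+ 2 / (16 * M%:R ^+ 2) :> R by rewrite divr_gt0 ?mulr_gt0 ?exprn_gt0.
  have := csc2_sum R n; rewrite -/M -M4 => S.
  have E2 : pi ^+ 2 / 8 = pi ^+ 2 / (16 * M%:R ^+ 2) * (2 * M%:R ^+ 2) :> R.
    by field; rewrite gt_eqF.
  have E3 : pi ^+ 2 / 16 * (2^-1) ^+ n = pi ^+ 2 / (16 * M%:R ^+ 2) * M%:R :> R.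
    by rewrite exprVn -natrX -/M; field; rewrite gt_eqF.
  rewrite E1 E2 E3 -mulrBr !ler_pM2l // -S; apply/andP; split; last first.
    apply: ler_sum_nat => k /andP[_ kM].
    by have /andP[] := inv_sqr_sin_bounds (basel_node_itv R kM).
  have -> : M%:R = \sum_(0 <= k < M) 1 :> R by rewrite sumr_const_nat subn0.
  rewrite -sumrB.
  apply: ler_sum_nat => k /andP[_ kM].
  by have /andP[] := inv_sqr_sin_bounds (basel_node_itv R kM).
apply: (squeeze_cvgr _ _ (cvg_cst _)).
- by apply: nearW => n; exact: H.
- rewrite -[X in _ --> X]subr0 -[X in _ - X](mulr0 (pi ^+ 2 / 16)).
  apply: cvgB; first exact: cvg_cst.
  by apply: cvgM; [exact: cvg_cst|apply: cvg_expr; rewrite ger0_norm; lra].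
Qed.

(** A limit [z] exists by monotonicity and the bound 2. Along powers of two the even terms form a
    quarter of the previous sum, so z = pi^2 / 8 + z / 4. *)
Lemma cvg_zeta2 (R : realType) : (fun n => zeta2 n) @ \oo --> (pi ^+ 2 / 6 : R).
Proof.
have zcvg : cvgn (@zeta2 R).
  apply: (@nondecreasing_is_cvgn _ zeta2); first by move=> m n; exact: zeta2_mono.
  by exists 2 => _ [n _ <-]; exact: zeta2_le2.
set z := limn (@zeta2 R) in zcvg *.
have z2 : (fun n => zeta2 (2 ^ n)) @ \oo --> z.
  apply: (cvg_comp (fun n => (2 ^ n)%N) _ _ zcvg) => A [N _ NA].
  by exists N => // n /= Nn; apply: NA => /=; exact: leq_trans Nn (ltnW (ltn_expl _ _)).
have z2' : (fun n => zeta2 (2 ^ n.+1)) @ \oo --> z.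
  by move: z2; rewrite -(cvg_shiftS (fun n => zeta2 (2 ^ n) : R)).
have D n : zeta2 (2 ^ n.+1) = odd_zeta2 R (2 ^ n) + 4^-1 * zeta2 (2 ^ n) :> R.
  rewrite /zeta2 (bigID (fun m => 2 %| m)%N) /= sum_multiples // expnS mulKn //.
  rewrite addrC; congr (_ + _); last first.
    rewrite mulr_sumr; apply: eq_bigr => m _.
    by rewrite natrM exprMn invfM; congr (_^-1 * _); rewrite -natrX.
  rewrite /odd_zeta2; elim: (2 ^ n)%N => [|M IH]; first by rewrite muln0 !big_geq.
  rewrite [RHS]big_nat_recr //= -IH mulnS add2n big_mkcond [in RHS]big_mkcond.
  by rewrite [in LHS]big_nat_recr //= [in LHS]big_nat_recr //= !dvdn2 /= oddM /= addr0 addn1.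
have : (fun n => zeta2 (2 ^ n.+1)) @ \oo --> pi ^+ 2 / 8 + 4^-1 * z.
  under eq_cvg do rewrite D.
  apply: cvgD; first exact: cvg_odd_zeta2.
  by apply: cvgM; [exact: cvg_cst | exact: z2].
move=> /(cvg_unique _ z2') => /(_ (@Rhausdorff R)) h.
have -> : pi ^+ 2 / 6 = z by rewrite /= in h; lra.
exact: zcvg.
Qed.

(** * The sum of the Möbius series *)

(** [sum_mobius_zeta2] is compared with the same sum having [z] in place of [zeta2 (N %/ d)]. The
    tails, of order d / N, leave an error of order (1 / N) times the sum of 1 / d; weakening 1 / d
    to 1 / sqrt d still gives O(N^(-1/2)). *)
Lemma cvg_mobius_series (R : realType) :
  (fun N => \sum_(1 <= d < N.+1) mobius d / d%:R ^+ 2) @ \oo --> (6 / pi ^+ 2 : R).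
Proof.
set A := fun N => _; have pi0 : 0 < pi :> R := pi_gt0 R.
set z : R := pi ^+ 2 / 6; have z0 : 0 < z by rewrite divr_gt0 ?exprn_gt0.
have zetaz : (fun n => zeta2 n) @ \oo --> z by exact: cvg_zeta2.
have zcvg : cvgn (@zeta2 R) by apply/cvg_ex; exists z.
have zlim : limn (@zeta2 R) = z by exact: cvg_lim zetaz.
have tail M : (0 < M)%N -> `|z - zeta2 M| <= M%:R^-1.
  move=> M0; rewrite ger0_norm; last first.
    rewrite subr_ge0 -zlim; apply: limr_ge => //.
    by near=> n; apply: zeta2_mono; near: n; exists M.
  rewrite lerBlDl -zlim; apply: limr_le => //.
  near=> n; apply: zeta2_tail; rewrite M0 /=; near: n; by exists M.
have bound N : (0 < N)%N -> `|A N - 6 / pi ^+ 2| <= 4 / z * Num.sqrt (N%:R^-1).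
  move=> N0; have N0' : 0 < N%:R :> R by rewrite ltr0n.
  have -> : A N - 6 / pi ^+ 2 =
      z^-1 * \sum_(1 <= d < N.+1) mobius d / d%:R ^+ 2 * (z - zeta2 (N %/ d)).
    under eq_bigr do rewrite mulrBr.
    rewrite sumrB sum_mobius_zeta2 // -mulr_suml mulrBr mulr1 mulrCA mulVf ?gt_eqF // mulr1.
    by rewrite /z invf_div.
  rewrite normrM gtr0_norm ?invr_gt0 // (mulrC 4) -mulrA ler_pM2l ?invr_gt0 //.
  apply: le_trans (ler_norm_sum _ _ _) _.
  apply: (@le_trans _ _ (2 / N%:R * \sum_(1 <= d < N.+1) (Num.sqrt d%:R)^-1)).
    rewrite mulr_sumr; apply: ler_sum_nat => d /andP[d0 dN].
    have d0' : 0 < d%:R :> R by rewrite ltr0n.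
    have Nd0 : (0 < N %/ d)%N by rewrite divn_gt0.
    rewrite !normrM normfV normrX [`|d%:R|]gtr0_norm //.
    (* From [d <= N] comes N < (N %/ d + 1) d <= 2 d (N %/ d). *)
    apply: (@le_trans _ _ (1 / d%:R ^+ 2 * (2 * d%:R / N%:R))).
      rewrite ler_pM ?divr_ge0 ?exprn_ge0 ?ler_pM2r ?invr_gt0 ?exprn_gt0 ?normr_mobius //.
      apply: le_trans (tail _ Nd0) _.
      rewrite -[leLHS]div1r ler_pdivrMr ?ltr0n // mulrAC ler_pdivlMr // mul1r.
      rewrite -!natrM ler_nat; have := ltn_ceil N d0; nia.
    have -> : 1 / d%:R ^+ 2 * (2 * d%:R / N%:R) = 2 / N%:R * d%:R^-1 :> R.
      by field; rewrite !gt_eqF.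
    rewrite ler_pM2l ?divr_gt0 // lef_pV2 ?posrE ?sqrtr_gt0 //.
    rewrite -{2}[d%:R]sqr_sqrtr ?ler0n // expr2 ler_peMr ?sqrtr_ge0 //.
    by rewrite -[leLHS]sqrtr1 ler_wsqrtr // ler1n.
  have := @sum_inv_sqrt R N; rewrite -(ler_pM2l (_ : 0 < 2 / N%:R :> R)) ?divr_gt0 //.
  move=> /le_trans; apply; rewrite sqrtrV ?ler0n // le_eqVlt; apply/orP; left; apply/eqP.
  have s0 : 0 < Num.sqrt (N%:R : R) by rewrite sqrtr_gt0.
  rewrite -[X in _ / X * _]sqr_sqrtr ?ler0n //; move: (Num.sqrt _) s0 => s s0.
  by field; rewrite gt_eqF.
rewrite -cvg_shiftS; apply: (@cvg_sub0 _ _ _ _ _ _ (fun=> 6 / pi ^+ 2)); last exact: cvg_cst.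
apply: norm_cvg0.
apply: (@squeeze_cvgr _ _ _ _ (fun=> 0) (fun n => 4 / z * Num.sqrt (n.+1%:R^-1))).
- by near=> n; rewrite normr_ge0 /=; exact: bound.
- exact: cvg_cst.
rewrite -[X in _ --> X](mulr0 (4 / z)); apply: cvgM; first exact: cvg_cst.
rewrite -[X in _ --> X]sqrtr0.
apply: (@cvg_comp _ _ _ harmonic Num.sqrt); first exact: cvg_harmonic.
exact: sqrt_continuous.
Unshelve. all: by end_near.
Qed.

(** * Binomial weights and divisibility *)

(** The recursion follows one step of the walk; the weights vanish for [t > k], so sums over [t] may
    run past [k]. *)
Fixpoint binom_pmf {R : pzRingType} (a : R) (k t : nat) : R :=
  if k is k'.+1 then
    (1 - a) * binom_pmf a k' t + (if t is t'.+1 then a * binom_pmf a k' t' else 0)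
  else (t == 0%N)%:R.

(** This recursive form is the one that the induction in [mean_walk] produces; [binom_meanE] links
    it to the weights. *)
Fixpoint binom_mean {R : pzRingType} (a : R) (k : nat) (g : nat -> R) : R :=
  if k is k'.+1 then
    a * binom_mean a k' (fun t => g t.+1) + (1 - a) * binom_mean a k' g
  else g 0%N.

Lemma binom_meanE (R : comPzRingType) (a : R) k g N : (k < N)%N ->
  binom_mean a k g = \sum_(0 <= t < N) binom_pmf a k t * g t.
Proof.
elim: k g N => [|k IH] g [//|N] kN.
  rewrite big_nat_recl //= mul1r big1 ?addr0 // => i _; exact: mul0r.
rewrite /= (IH _ N) // (IH _ N.+1) 1?ltnW // !mulr_sumr.
under [in RHS]eq_bigr do rewrite mulrDl.
rewrite big_split /= [RHS]addrC; congr (_ + _).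
  rewrite [RHS]big_nat_recl //= mul0r add0r.
  by apply: eq_bigr => i _; rewrite mulrA.
by apply: eq_bigr => i _; rewrite mulrA.
Qed.

Lemma binom_meanD (R : comPzRingType) (a : R) k f g :
  binom_mean a k (fun t => f t + g t) = binom_mean a k f + binom_mean a k g.
Proof. by rewrite !(binom_meanE _ _ (ltnSn k)) -big_split; apply: eq_bigr => i _; rewrite mulrDr. Qed.

Lemma binom_meanZ (R : comPzRingType) (a c : R) k f :
  binom_mean a k (fun t => c * f t) = c * binom_mean a k f.
Proof. by rewrite !(binom_meanE _ _ (ltnSn k)) mulr_sumr; apply: eq_bigr => i _; rewrite mulrCA. Qed.

Lemma binom_mean_cst (R : comPzRingType) (a c : R) k : binom_mean a k (fun=> c) = c.
Proof. by elim: k => //= k ->; ring. Qed.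

Lemma binom_pmf_ge0 (R : realDomainType) (a : R) k t : 0 <= a <= 1 -> 0 <= binom_pmf a k t.
Proof.
case/andP=> a0 a1; elim: k t => [|k IH] [|t] //=; rewrite ?ler0n //.
  by rewrite addr0 mulr_ge0 ?subr_ge0.
by rewrite addr_ge0 // mulr_ge0 ?subr_ge0.
Qed.

(** The shift [x] is left free because a step to the right replaces it by [1 + x]. *)
Lemma binom_variance (R : comPzRingType) (a : R) k (x : R) :
  binom_mean a k (fun t => (t%:R + x) ^+ 2) =
  (a *+ k + x) ^+ 2 + (a * (1 - a)) *+ k.
Proof.
elim: k x => [|k IH] x /=; first by rewrite !mulr0n addr0.
rewrite (_ : (fun t => (t.+1%:R + x) ^+ 2) = (fun t => (t%:R + (1 + x)) ^+ 2)).
  by rewrite !IH !mulrS; move: (a *+ k) ((a * (1 - a)) *+ k) => u v; ring.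
by apply/funext => t; rewrite -natr1 addrA.
Qed.

(** The absorption identities of binomial coefficients, proved together because the induction step
    of each uses both. *)
Lemma binom_pmf_absorb (R : comPzRingType) (a : R) k t :
  t.+1%:R * binom_pmf a k.+1 t.+1 = k.+1%:R * (a * binom_pmf a k t) /\
  (k.+1%:R - t%:R) * binom_pmf a k.+1 t = k.+1%:R * ((1 - a) * binom_pmf a k t).
Proof.
elim: k t => [|k IH] t.
  by case: t => [|[|t]] /=; split; rewrite -?natr1; ring.
have step u : binom_pmf a k.+2 u.+1 = (1 - a) * binom_pmf a k.+1 u.+1 + a * binom_pmf a k.+1 u.
  by [].
have step0 : binom_pmf a k.+2 0 = (1 - a) * binom_pmf a k.+1 0 by rewrite [LHS]/= addr0.
split.
  have [] := IH t; rewrite step; move: (binom_pmf a _ _) (binom_pmf a _ _) (binom_pmf a _ _) => x y z.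
  rewrite -!natr1 => H1 H2.
  transitivity ((1 - a) * ((t%:R + 1) * z) + (t%:R + 1) * (a * x)); first ring.
  rewrite H1; transitivity (a * ((k%:R + 1) * ((1 - a) * y)) + (t%:R + 1) * (a * x)); first ring.
  rewrite -H2; ring.
case: t => [|u]; first by rewrite step0; ring.
have [] := IH u; rewrite step; move: (binom_pmf a _ _) (binom_pmf a _ _) (binom_pmf a _ _) => x y z.
rewrite -!natr1 => H1 H2.
transitivity (a * ((k%:R + 1 - u%:R) * x) + (k%:R + 1 - u%:R) * ((1 - a) * z)); first ring.
rewrite H2; transitivity ((1 - a) * ((k%:R + 1) * (a * y)) + (k%:R + 1 - u%:R) * ((1 - a) * z)); first ring.
rewrite -H1; ring.
Qed.

(* Turns the total variation of the binomial weights into a first absolute moment. *)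
Lemma binom_pmf_diff (R : comPzRingType) (a : R) k t :
  k.+1%:R * (a * (1 - a)) * (binom_pmf a k t.+1 - binom_pmf a k t) =
  binom_pmf a k.+1 t.+1 * (k.+1%:R * a - t.+1%:R).
Proof.
have [H1 _] := binom_pmf_absorb a k t; have [_ H2] := binom_pmf_absorb a k t.+1.
rewrite [RHS](_ : _ = a * ((k.+1%:R - t.+1%:R) * binom_pmf a k.+1 t.+1) -
  (1 - a) * (t.+1%:R * binom_pmf a k.+1 t.+1)); last ring.
rewrite H1 H2; ring.
Qed.

(** By [binom_pmf_diff], [v] times the variation is at most the mean absolute deviation of a
    binomial variable with [k.+1] trials, whose variance is [v]. That deviation is at most [s], the
    root of [v], and [v / s = s]. *)
Lemma binom_total_variation (R : rcfType) (a : R) k N : 0 < a < 1 ->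
  \sum_(0 <= t < N) `|binom_pmf a k t.+1 - binom_pmf a k t| <=
  (Num.sqrt (k.+1%:R * (a * (1 - a))))^-1.
Proof.
case/andP=> a0 a1; have a01 : 0 <= a <= 1 by rewrite !ltW.
set v := k.+1%:R * (a * (1 - a)).
have v0 : 0 < v by rewrite mulr_gt0 ?ltr0n // mulr_gt0 // subr_gt0.
set s := Num.sqrt v; have s0 : 0 < s by rewrite sqrtr_gt0.
have sv : v = s ^+ 2 by rewrite sqr_sqrtr // ltW.
(* AM-GM: [2 |x| <= x^2 / s + s] for the deviation [x] from the mean *)
have step t : v * `|binom_pmf a k t.+1 - binom_pmf a k t| <=
    binom_pmf a k.+1 t.+1 * (((t.+1%:R - k.+1%:R * a) ^+ 2 / s + s) / 2).
  rewrite -[v]gtr0_norm // -normrM binom_pmf_diff normrM ger0_norm ?binom_pmf_ge0 //.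
  apply: ler_wpM2l; first exact: binom_pmf_ge0.
  rewrite distrC; move: (t.+1%:R - _) => x.
  rewrite ler_pdivlMr // -[x ^+ 2]real_normK ?num_real // -lerBlDr ler_pdivlMr //.
  have := sqr_ge0 (`|x| - s); nra.
rewrite -(ler_pM2l v0) mulr_sumr.
have -> : v / s = s by rewrite sv; field; rewrite gt_eqF.
apply: le_trans (ler_sum _ (fun t _ => step t)) _.
set h := fun t : nat => ((t%:R - k.+1%:R * a) ^+ 2 / s + s) / 2.
have h0 t : 0 <= h t by rewrite divr_ge0 ?addr_ge0 ?divr_ge0 ?sqr_ge0 ?ltW.
apply: (@le_trans _ _ (binom_mean a k.+1 h)); last first.
  rewrite (_ : h = fun t => (2 * s)^-1 * (t%:R + - (k.+1%:R * a)) ^+ 2 + s / 2).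
    rewrite binom_meanD binom_mean_cst binom_meanZ binom_variance -[a *+ _]mulr_natl subrr expr0n add0r.
    rewrite -[_ *+ k.+1]mulr_natl -/v sv le_eqVlt; apply/orP; left; apply/eqP.
    by field; rewrite gt_eqF.
  by apply/funext => t; rewrite /h; field; rewrite gt_eqF.
(* The range [N + k.+2] contains both the support and the indices [t.+1] with [t < N]; the surplus
   terms are nonnegative. *)
rewrite (@binom_meanE _ _ _ _ (N + k.+2)) ?leq_addl //.
rewrite addnS big_nat_recl // [X in _ <= _ + X](big_cat_nat (n := N)) ?leq_addr //.
rewrite addrCA lerDl addr_ge0 //; first by rewrite mulr_ge0 ?binom_pmf_ge0.
by apply: sumr_ge0 => t _; rewrite mulr_ge0 ?binom_pmf_ge0.
Qed.

(** Each block of [d] consecutive indices contains one multiple of [d], its first. Comparing the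
    value there with the block average costs at most the variation of [b] along the block. *)
Lemma sum_multiples_average (R : realFieldType) (b : nat -> R) d M : (0 < d)%N ->
  `|\sum_(0 <= t < M * d) b t * (d %| t)%:R - (\sum_(0 <= t < M * d) b t) / d%:R| <=
  \sum_(0 <= t < M * d) `|b t.+1 - b t|.
Proof.
move=> d0; have d0' : 0 < d%:R :> R by rewrite ltr0n.
elim: M => [|M IH]; first by rewrite mul0n !big_geq // mul0r subr0 normr0.
have split_sum (F : nat -> R) : \sum_(0 <= t < M.+1 * d) F t =
    \sum_(0 <= t < M * d) F t + \sum_(0 <= r < d) F (r + M * d)%N.
  rewrite (big_cat_nat (n := (M * d)%N)) ?leq_mul2r ?leqnSn ?orbT //=; congr (_ + _).
  by rewrite -{1}[(M * d)%N]add0n big_addn mulSn addnK.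
rewrite !split_sum mulrDl opprD addrACA; apply: le_trans (ler_normD _ _) (lerD IH _).
have -> : \sum_(0 <= r < d) b (r + M * d)%N * (d %| r + M * d)%:R = b (M * d)%N.
  rewrite big_ltn // add0n dvdn_mull // mulr1 big_nat_cond big1 ?addr0 // => r.
  rewrite andbT => /andP[r0 rd]; rewrite dvdn_addl ?dvdn_mull // gtnNdvd // mulr0.
  by [].
set b' := fun r => b (r + M * d)%N.
have Hb r : (r <= d)%N -> `|b' 0 - b' r| <= \sum_(0 <= u < d) `|b' u.+1 - b' u|.
  move=> rd; rewrite distrC -(telescope_sumr b' (leq0n r)).
  apply: le_trans (ler_norm_sum _ _ _) _.
  by rewrite [leRHS](big_cat_nat (n := r)) //= lerDl sumr_ge0.
have -> : b (M * d)%N - (\sum_(0 <= r < d) b (r + M * d)%N) / d%:R =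
    (\sum_(0 <= r < d) (b' 0 - b' r)) / d%:R.
  by rewrite [in RHS]sumrB sumr_const_nat subn0 [RHS]mulrBl -(mulr_natr (b' 0)) mulfK ?gt_eqF.
rewrite normrM normfV [`|d%:R|]gtr0_norm // ler_pdivrMr //.
apply: le_trans (ler_norm_sum _ _ _) _; rewrite mulr_natr.
rewrite -[X in _ *+ X](subn0 d) -sumr_const_nat.
by apply: ler_sum_nat => r /andP[_ rd]; apply: Hb; exact: ltnW.
Qed.

Lemma binom_mean_dvdn (R : rcfType) (a : R) k d : 0 < a < 1 -> (0 < d)%N ->
  `|binom_mean a k (fun t => (d %| t)%:R) - d%:R^-1| <=
  (Num.sqrt (k.+1%:R * (a * (1 - a))))^-1.
Proof.
(* The range [k.+1 * d] is a multiple of [d], as the block estimate requires, and covers [t <= k],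
   so the weights sum to 1. *)
move=> a01 d0; apply: le_trans (binom_total_variation k (k.+1 * d) a01).
have kd : (k < k.+1 * d)%N by rewrite leq_pmulr.
have h := binom_mean_cst a 1 k; rewrite (binom_meanE _ _ kd) in h.
rewrite (binom_meanE _ _ kd) -[d%:R^-1]mul1r -[X in X / _]h.
under [X in X / _]eq_bigr do rewrite mulr1.
exact: sum_multiples_average.
Qed.

(** * Bounded random variables and their means *)

(** Boundedness makes the class stable under products as well as sums, so integrability always
    follows from closure lemmas. *)
Definition bounded_rv d (T : measurableType d) (R : realType) (f : T -> R) : Prop :=
  measurable_fun setT f /\ exists M, forall x, `|f x| <= M.

Definition mean d (T : measurableType d) (R : realType) (P : probability T R)
  (f : T -> R) : R := \int[P]_x f x.

Lemma bounded_rv_cst d (T : measurableType d) (R : realType) (c : R) :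
  bounded_rv (fun _ : T => c).
Proof. by split; [exact: measurable_cst|exists `|c|]. Qed.

Lemma bounded_rvD d (T : measurableType d) (R : realType) (f g : T -> R) :
  bounded_rv f -> bounded_rv g -> bounded_rv (fun x => f x + g x).
Proof.
move=> [mf [M fM]] [mg [N gN]]; split; first exact: measurable_funD.
by exists (M + N) => x; apply: le_trans (ler_normD _ _) (lerD (fM x) (gN x)).
Qed.

Lemma bounded_rvM d (T : measurableType d) (R : realType) (f g : T -> R) :
  bounded_rv f -> bounded_rv g -> bounded_rv (fun x => f x * g x).
Proof.
move=> [mf [M fM]] [mg [N gN]]; split; first exact: measurable_funM.
by exists (M * N) => x; rewrite normrM ler_pM.
Qed.

Lemma bounded_rvZ d (T : measurableType d) (R : realType) (c : R) (f : T -> R) :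
  bounded_rv f -> bounded_rv (fun x => c * f x).
Proof. exact/bounded_rvM/bounded_rv_cst. Qed.

Lemma bounded_rv_norm d (T : measurableType d) (R : realType) (f : T -> R) :
  bounded_rv f -> bounded_rv (fun x => `|f x|).
Proof.
move=> [mf [M fM]]; split; first exact: measurableT_comp.
by exists M => x; rewrite normr_id.
Qed.

Lemma bounded_rv_indic d (T : measurableType d) (R : realType) (A : set T) :
  measurable A -> bounded_rv (\1_A : T -> R).
Proof.
move=> mA; split; first exact: measurable_indic.
by exists 1 => x; rewrite indicE; case: (_ \in _); rewrite ?normr0 ?normr1.
Qed.

Lemma bounded_rv_sum d (T : measurableType d) (R : realType) (I : Type) (s : seq I)
  (Q : pred I) (f : I -> T -> R) :
  (forall i, bounded_rv (f i)) -> bounded_rv (fun x => \sum_(i <- s | Q i) f i x).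
Proof.
move=> bf; elim: s => [|i s IH].
  rewrite (_ : (fun x => _) = fun=> 0); first exact: bounded_rv_cst.
  by apply/funext => x; rewrite big_nil.
rewrite (_ : (fun x => _) = fun x => (if Q i then f i x else 0) + \sum_(j <- s | Q j) f j x).
  apply: bounded_rvD => //; case: (Q i) => //; exact: bounded_rv_cst.
by apply/funext => x; rewrite big_cons; case: ifP; rewrite ?add0r.
Qed.

Lemma bounded_rv_prod d (T : measurableType d) (R : realType) (I : Type) (s : seq I)
  (f : I -> T -> R) :
  (forall i, bounded_rv (f i)) -> bounded_rv (fun x => \prod_(i <- s) f i x).
Proof.
move=> bf; elim: s => [|i s IH].
  rewrite (_ : (fun x => _) = fun=> 1); first exact: bounded_rv_cst.
  by apply/funext => x; rewrite big_nil.
rewrite (_ : (fun x => _) = fun x => f i x * \prod_(j <- s) f j x); first exact: bounded_rvM.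
by apply/funext => x; rewrite big_cons.
Qed.

Lemma bounded_rv_integrable d (T : measurableType d) (R : realType)
  (P : probability T R) (f : T -> R) : bounded_rv f -> P.-integrable setT (EFin \o f).
Proof.
move=> [mf [M fM]]; apply: measurable_bounded_integrable => //.
  by rewrite [X in (X < _)%E](_ : _ = 1%E) ?ltry //; exact: probability_setT.
exists M; split; first by rewrite num_real.
by move=> N MN x _; apply: le_trans (fM x) (ltW MN).
Qed.

Section MeanTheory.
Context d (T : measurableType d) (R : realType) (P : probability T R).
Implicit Types f g : T -> R.

Lemma meanD f g : bounded_rv f -> bounded_rv g ->
  mean P (fun x => f x + g x) = mean P f + mean P g.
Proof. by move=> bf bg; rewrite /mean RintegralD //; exact: bounded_rv_integrable. Qed.

Lemma meanZ (c : R) f : bounded_rv f -> mean P (fun x => c * f x) = c * mean P f.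
Proof. by move=> bf; rewrite /mean RintegralZl //; exact: bounded_rv_integrable. Qed.

Lemma mean_cst (c : R) : mean P (fun=> c) = c.
Proof.
rewrite /mean (@Rintegral_cst _ _ _ P setT) // [X in fine X](_ : _ = 1%E) ?mulr1 //.
exact: probability_setT.
Qed.

Lemma le_mean f g : bounded_rv f -> bounded_rv g -> (forall x, f x <= g x) ->
  mean P f <= mean P g.
Proof.
by move=> bf bg fg; rewrite /mean le_Rintegral //; exact: bounded_rv_integrable.
Qed.

Lemma mean_sum (I : Type) (s : seq I) (Q : pred I) (f : I -> T -> R) :
  (forall i, bounded_rv (f i)) ->
  mean P (fun x => \sum_(i <- s | Q i) f i x) = \sum_(i <- s | Q i) mean P (f i).
Proof.
move=> bf; elim: s => [|i s IH].
  rewrite big_nil (_ : (fun x => _) = fun=> 0) ?mean_cst //.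
  by apply/funext => x; rewrite big_nil.
rewrite big_cons; case: ifP => Qi.
  rewrite -IH -meanD //; last exact: bounded_rv_sum.
  by congr mean; apply/funext => x; rewrite big_cons Qi.
by rewrite -IH; congr mean; apply/funext => x; rewrite big_cons Qi.
Qed.

Lemma mean_indic (A : set T) : measurable A -> mean P \1_A = fine (P A).
Proof.
by move=> mA; rewrite /mean /Rintegral integral_indic // setIT.
Qed.

(** A form of Cauchy-Schwarz through 2|f| <= f^2 / s + s; any convenient [s] near the root of [v]
    will do. *)
Lemma mean_norm_le f s v : 0 < s -> bounded_rv f ->
  mean P (fun x => f x ^+ 2) <= v -> mean P (fun x => `|f x|) <= (v / s + s) / 2.
Proof.
move=> s0 bf fv.
have bf2 : bounded_rv (fun x => f x ^+ 2) by exact: bounded_rvM.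
apply: (@le_trans _ _ (mean P (fun x => (2 * s)^-1 * f x ^+ 2 + s / 2))).
  apply: le_mean; first exact: bounded_rv_norm.
    apply: bounded_rvD; [exact: bounded_rvZ|exact: bounded_rv_cst].
  move=> x; rewrite -[f x ^+ 2]real_normK ?num_real //.
  have -> : (2 * s)^-1 * `|f x| ^+ 2 + s / 2 = (`|f x| ^+ 2 / s + s) / 2.
    by field; rewrite gt_eqF.
  rewrite ler_pdivlMr // -lerBlDr ler_pdivlMr //; have := sqr_ge0 (`|f x| - s); nra.
rewrite meanD; [|exact: bounded_rvZ|exact: bounded_rv_cst].
rewrite meanZ // mean_cst.
have -> : (v / s + s) / 2 = (2 * s)^-1 * v + s / 2 by field; rewrite gt_eqF.
by rewrite lerD2r ler_pM2l // invr_gt0 mulr_gt0.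
Qed.

End MeanTheory.

(** * Visibility and averages, path by path *)

Lemma walk_x_le (T : Type) (E : nat -> set T) n w : (walk_x E n w <= n)%N.
Proof.
apply: leq_trans (leq_sum _ (fun i _ => leq_b1 _)) _.
by rewrite sum1_card card_ord.
Qed.

Lemma XvisE (T : Type) (E : nat -> set T) n w :
  Xvis E n w = (gcdn (walk_x E n w) n == 1%N) :> nat.
Proof.
by rewrite /Xvis /visible /walk_y -gcdnDl subnKC ?walk_x_le.
Qed.

Lemma Xvis_mobius (R : comPzRingType) (T : Type) (E : nat -> set T) n w : (0 < n)%N ->
  (Xvis E n w)%:R =
  \sum_(1 <= q < n.+1 | (q %| n)%N) mobius q * (q %| walk_x E n w)%:R :> R.
Proof.
move=> n0; rewrite XvisE; set g := gcdn _ _.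
have g0 : (0 < g)%N by rewrite gcdn_gt0 n0 orbT.
rewrite -(sum_mobius R g0) [LHS](big_nat_widen _ _ n.+1); last first.
  by rewrite ltnS dvdn_leq // dvdn_gcdr.
rewrite [RHS]big_mkcond [LHS]big_mkcond; apply: eq_big_nat => q /andP[q0 _].
rewrite dvdn_gcd; case: (boolP (q %| n)%N) => qn; rewrite ?andbF // andbT.
case: (boolP (q %| _)%N) => qw; rewrite ?mulr0 ?mulr1 //=.
by rewrite ltnS dvdn_leq // dvdn_gcd qw.
Qed.

Lemma sum_Xvis (R : comPzRingType) (T : Type) (E : nat -> set T) n w :
  \sum_(1 <= i < n.+1) (Xvis E i w)%:R =
  \sum_(1 <= q < n.+1) mobius q * \sum_(1 <= m < (n %/ q).+1) (q %| walk_x E (q * m) w)%:R :> R.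
Proof.
transitivity (\sum_(1 <= i < n.+1) \sum_(1 <= q < n.+1 | (q %| i)%N)
    mobius q * (q %| walk_x E i w)%:R : R).
  apply: eq_big_nat => i /andP[i0 iN]; rewrite (Xvis_mobius _ _ _ i0).
  rewrite [LHS](big_nat_widen _ _ n.+1) //.
  rewrite [LHS]big_mkcond [RHS]big_mkcond; apply: eq_big_nat => q _.
  case: (boolP (q %| i)%N) => //= qi.
  by have -> : (q < i.+1)%N by exact: dvdn_leq i0 qi.
rewrite (exchange_big_dep_nat xpredT) //=; apply: eq_big_nat => q /andP[q0 _].
by rewrite -mulr_sumr sum_multiples.
Qed.

(** Bernoulli's inequality, applied with exponent 16 to the ratio of consecutive bases. *)
Lemma onem_expr_le (R : realDomainType) (x : R) n : 0 <= x <= 1 ->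
  1 - x ^+ n <= n%:R * (1 - x).
Proof.
move=> x01; elim: n => [|n IH]; first by rewrite expr0 subrr mul0r.
have xn : 0 <= x ^+ n <= 1 by case/andP: x01 => x0 x1; rewrite exprn_ge0 // exprn_ile1.
rewrite exprSr -natr1; move: IH xn; move: (x ^+ n) (n%:R) => y z; nra.
Qed.

(** The difference is (t - (s / N)(n - N)) / n, and both [t] and (s / N)(n - N) lie between 0 and n
    - N. *)
Lemma Sbar_close (R : realType) (T : Type) (E : nat -> set T) N n w : (0 < N <= n)%N ->
  `|Sbar E n w - Sbar E N w| <= 1 - N%:R / n%:R :> R.
Proof.
case/andP=> N0 Nn; have n0 := leq_trans N0 Nn.
have N0' : 0 < N%:R :> R by rewrite ltr0n.
have n0' : 0 < n%:R :> R by rewrite ltr0n.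
rewrite /Sbar; set s := \sum_(1 <= i < N.+1) _.
have sN : (0 : R) <= s <= N%:R.
  rewrite sumr_ge0 //=.
  rewrite -[leRHS](_ : \sum_(1 <= i < N.+1) 1 = _); last by rewrite sumr_const_nat subn1.
  by apply: ler_sum => i _; rewrite lern1 leq_b1.
rewrite (big_cat_nat (n := N.+1)) //= -/s; set t := \sum_(N.+1 <= i < n.+1) _.
have tN : (0 : R) <= t <= n%:R - N%:R.
  rewrite sumr_ge0 //= -natrB //.
  rewrite -[leRHS](_ : \sum_(N.+1 <= i < n.+1) 1 = _); last by rewrite sumr_const_nat subSS.
  by apply: ler_sum => i _; rewrite lern1 leq_b1.
have Nn' : N%:R <= n%:R :> R by rewrite ler_nat.
have -> : (s + t) / n%:R - s / N%:R = (t - s / N%:R * (n%:R - N%:R)) / n%:R.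
  by field; rewrite !gt_eqF.
have -> : 1 - N%:R / n%:R = (n%:R - N%:R) / n%:R :> R by field; rewrite gt_eqF.
rewrite normrM normfV [`|n%:R|]gtr0_norm // ler_pM2r ?invr_gt0 //.
have : 0 <= s / N%:R <= 1.
  by case/andP: sN => s0 s1; rewrite divr_ge0 ?ler_pdivrMr ?mul1r // ltW.
by rewrite ler_norml; move: (s / _) => u; nra.
Qed.

(** With [k] the largest base such that [k ^ 16 <= n], the averages at [n] and at [k ^ 16] differ by
    at most 1 - (k / (k+1))^16 <= 16 / (k+1). *)
Lemma cvg_Sbar_subseq (R : realType) (T : Type) (E : nat -> set T) w (c : R) :
  (fun k => Sbar E (k.+1 ^ 16) w) @ \oo --> c -> (fun n => Sbar E n w) @ \oo --> c.
Proof.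
move=> sub; apply/cvgrPdist_le => e e0.
have e2 : 0 < e / 2 by rewrite divr_gt0.
have /cvgrPdist_le/(_ _ e2)[K1 _ HK1] := sub.
have H16 : (fun k : nat => 16 * harmonic k : R) @ \oo --> 0.
  by rewrite -[X in _ --> X](mulr0 16); apply: cvgM; [exact: cvg_cst|exact: cvg_harmonic].
have /cvgrPdist_le/(_ _ e2)[K2 _ HK2] := H16.
pose K := (maxn K1 K2).+1; exists (K ^ 16)%N => // n /= Kn.
have exk : exists k, (k ^ 16 <= n)%N by exists K.
have ubk k : (k ^ 16 <= n -> k <= n)%N.
  by apply: leq_trans; case: k => // k; rewrite -{1}[k.+1]expn1 leq_pexp2l.
case: (ex_maxnP exk ubk) => k kn kmax.
have Kk : (K <= k)%N by exact: kmax.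
have nk : (n < k.+1 ^ 16)%N by rewrite ltnNge; apply/negP => /kmax; rewrite ltnn.
case: k kn kmax Kk nk => [//|k] kn _ Kk nk.
have h1 : `|c - Sbar E (k.+1 ^ 16) w| <= e / 2.
  by apply: HK1 => /=; rewrite -ltnS; apply: leq_trans Kk; rewrite ltnS leq_maxl.
have h2 : `|Sbar E n w - Sbar E (k.+1 ^ 16) w| <= e / 2.
  have kn0 : (0 < k.+1 ^ 16 <= n)%N by rewrite expn_gt0.
  apply: le_trans (Sbar_close R E w kn0) _.
  have n0 : 0 < n%:R :> R by rewrite ltr0n (leq_trans _ kn) // expn_gt0.
  apply: (@le_trans _ _ (1 - (k.+1%:R / k.+2%:R) ^+ 16)).
    rewrite lerD2l lerN2 expr_div_n -!natrX ler_pM2l ?ltr0n ?expn_gt0 //.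
    by rewrite lef_pV2 ?posrE ?n0 ?ltr0n ?expn_gt0 // ler_nat ltnW.
  apply: (@le_trans _ _ (16%:R * (1 - k.+1%:R / k.+2%:R))).
    apply: onem_expr_le; rewrite divr_ge0 ?ler0n //= ler_pdivrMr ?ltr0n // mul1r.
    by rewrite ler_nat.
  have -> : 1 - k.+1%:R / k.+2%:R = harmonic k.+1 :> R.
    rewrite /harmonic /= -[k.+2%:R]natr1; have : 0 < k.+1%:R :> R by rewrite ltr0n.
    by move: (k.+1%:R) => x x0; field; rewrite gt_eqF // addr_gt0.
  have : `|0 - 16 * harmonic k.+1| <= e / 2 :> R.
    by apply: HK2 => /=; apply: leq_trans Kk; rewrite leqW // leq_maxr.
  by rewrite sub0r normrN ger0_norm // mulr_ge0 // invr_ge0.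
rewrite -(subrKA (Sbar E (k.+1 ^ 16) w)); apply: le_trans (ler_normD _ _) _.
rewrite [in X in _ + X]distrC; lra.
Qed.

(** * Almost sure convergence from summable means *)

(** The series [F] has integral at most [B], so it is finite almost everywhere, and the terms of a
    convergent series tend to 0. *)
Lemma summable_means_cvg0 d (T : measurableType d) (R : realType) (P : probability T R)
  (f : nat -> T -> R) (B : R) :
  (forall k, bounded_rv (f k)) -> (forall k x, 0 <= f k x) ->
  (forall n, \sum_(0 <= k < n) mean P (f k) <= B) ->
  {ae P, forall x, f k x @[k --> \oo] --> (0 : R)}.
Proof.
move=> bf f0 sumB.
pose F x := (\sum_(k <oo) (f k x)%:E)%E.
have mf k : measurable_fun setT (EFin \o f k) by apply/measurable_EFinP; exact: (proj1 (bf k)).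
have F0 x : (0 <= F x)%E by apply: nneseries_ge0 => k _ _; rewrite lee_fin.
have mF : measurable_fun setT F.
  by apply: (ge0_emeasurable_sum (h := fun k => EFin \o f k)) => [k x _ _|k _] //=; rewrite lee_fin.
have meanE k : (\int[P]_x (f k x)%:E)%E = (mean P (f k))%:E.
  rewrite /mean /Rintegral fineK //; apply: integrable_fin_num => //.
  exact: bounded_rv_integrable.
have intF : (\int[P]_x F x <= B%:E)%E.
  rewrite /F (integral_nneseries P measurableT mf); last by move=> k x _; rewrite /= lee_fin.
  apply: lime_le.
    by apply: is_cvg_nneseries => k _ _; apply: integral_ge0 => x _; rewrite lee_fin.
  apply: nearW => n; rewrite (eq_bigr (fun k => (mean P (f k))%:E)) => [|k _]; last exact: meanE.
  by rewrite sumEFin lee_fin.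
have iF : P.-integrable setT F.
  apply/integrableP; split => //.
  under eq_integral do rewrite gee0_abs //.
  exact: le_lt_trans intF (ltry _).
apply: filterS (integrable_ae measurableT iF) => x /(_ I) finF.
apply: cvg_series_cvg_0; apply: nnseries_is_cvg => //.
by rewrite -/(F x) ltey_eq finF.
Qed.

(** * Independence of past and future steps *)

(* f depends only on the first n steps, in the form needed here: it is uncorrelated with products
   of indicators of later steps. *)
Definition future_indep d (T : measurableType d) (R : realType)
  (P : probability T R) (a : R) (E : nat -> set T) (n : nat) (f : T -> R) : Prop :=
  bounded_rv f /\ forall F : seq nat, uniq F -> all (leq n) F ->
    mean P (fun w => f w * \prod_(i <- F) \1_(E i) w) = mean P f * a ^+ size F.

Section Walk.
Context d (T : measurableType d) (R : realType) (P : probability T R) (a : R)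
  (E : nat -> set T) (mE : forall i, measurable (E i))
  (PE : forall i, P (E i) = a%:E) (indepE : mutually_independent P E).

(** A product of indicators is the indicator of an intersection, so this is mutual independence
    itself, and the only place where it is applied directly. *)
Lemma future_indep_cst1 : future_indep P a E 0 (fun=> 1).
Proof.
split; first exact: bounded_rv_cst.
move=> F uF _; rewrite mean_cst mul1r.
have -> : (fun w => 1 * \prod_(i <- F) \1_(E i) w) =
    \1_(\bigcap_(i in [set j | j \in F]) E i) :> (T -> R).
  apply/funext => w; rewrite mul1r indicE; case: (boolP (_ \in _)) => [|].
    rewrite inE => H; rewrite big_seq big1 // => i iF.
    by rewrite indicE mem_set //; exact: H.
  move=> /negP H; apply/eqP; rewrite prodf_seq_eq0; apply: contra_notT H => /hasPn H.
  rewrite inE => i /= /H; rewrite indicE; case: (boolP (w \in E i)) => [|_]; last by rewrite eqxx.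
  by rewrite inE.
rewrite mean_indic; last by apply: fin_bigcap_measurable => // ; exact: finite_seq.
rewrite indepE // (eq_bigr (fun=> a%:E)) //.
rewrite prodEFin /= big_const_seq count_predT; exact: iter_mulr_1.
Qed.

Lemma future_indepW m n f : (m <= n)%N ->
  future_indep P a E m f -> future_indep P a E n f.
Proof.
move=> mn [bf H]; split => // F uF nF; apply: H => //.
by apply: sub_all nF => i; exact: leq_trans.
Qed.

Lemma future_indepD n f g :
  future_indep P a E n f -> future_indep P a E n g ->
  future_indep P a E n (fun w => f w + g w).
Proof.
move=> [bf Hf] [bg Hg]; split; first exact: bounded_rvD.
move=> F uF nF; rewrite meanD // mulrDl -Hf // -Hg // -meanD.
- by congr mean; apply/funext => w; rewrite mulrDl.
- by apply: bounded_rvM => //; apply: bounded_rv_prod => i; exact: bounded_rv_indic.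
- by apply: bounded_rvM => //; apply: bounded_rv_prod => i; exact: bounded_rv_indic.
Qed.

Lemma future_indepZ n (c : R) f :
  future_indep P a E n f -> future_indep P a E n (fun w => c * f w).
Proof.
move=> [bf Hf]; split; first exact: bounded_rvZ.
move=> F uF nF; rewrite meanZ // -mulrA -Hf // -meanZ.
- by congr mean; apply/funext => w; rewrite mulrA.
- by apply: bounded_rvM => //; apply: bounded_rv_prod => i; exact: bounded_rv_indic.
Qed.

Lemma future_indep_mean_indic n f : future_indep P a E n f ->
  mean P (fun w => f w * \1_(E n) w) = mean P f * a.
Proof.
move=> [_ /(_ [:: n] isT)]; rewrite /= leqnn expr1 => <- //.
by congr mean; apply/funext => w; rewrite big_seq1.
Qed.

(** The identity for [f] is applied to the list [n :: F], which moves step [n] from the future into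
    the past. *)
Lemma future_indep_indic n f : future_indep P a E n f ->
  future_indep P a E n.+1 (fun w => f w * \1_(E n) w).
Proof.
move=> nf; have [bf Hf] := nf.
split; first by apply: bounded_rvM => //; exact: bounded_rv_indic.
move=> F uF nF; rewrite (future_indep_mean_indic nf) -mulrA -exprS.
rewrite -(Hf (n :: F)) /=.
- by congr mean; apply/funext => w; rewrite big_cons mulrA.
- by rewrite uF andbT; apply/negP => /(allP nF); rewrite ltnn.
- by rewrite leqnn; apply: sub_all nF => i; exact: ltnW.
Qed.

Lemma walk_xD i k w : walk_x E (i + k) w = (walk_x E i w + walk_x (fun j => E (i + j)) k w)%N.
Proof. by rewrite /walk_x big_split_ord. Qed.

(** Splitting on step [i + k] reproduces the recursion of [binom_mean]. Both claims go together: the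
    mean after [k.+1] steps needs the independence after [k]. A general [f] allows the walk to be
    examined at two times. *)
Lemma mean_walk i k f (g : nat -> R) : future_indep P a E i f ->
  let h w := f w * g (walk_x (fun j => E (i + j)) k w) in
  future_indep P a E (i + k) h /\ mean P h = mean P f * binom_mean a k g.
Proof.
move=> nf; elim: k g => [|k IH] g.
  rewrite addn0 /=; set h := fun w => _.
  have -> : h = fun w => g 0%N * f w.
    by apply/funext => w; rewrite /h /walk_x big_ord0 mulrC.
  split; first exact: future_indepZ.
  by rewrite meanZ; [exact: mulrC | exact: (proj1 nf)].
have [h1 m1] := IH (fun t => g t.+1); have [h0 m0] := IH g.
pose f1 w := f w * g (walk_x (fun j => E (i + j)) k w).+1.
pose f0 w := f w * g (walk_x (fun j => E (i + j)) k w).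
rewrite -/f1 in h1 m1; rewrite -/f0 in h0 m0; move=> h.
(* The complement of the event enters as 1 minus its indicator, so only linear combinations are
   needed. *)
have -> : h = fun w => (f1 w * \1_(E (i + k)) w + f0 w) + (-1) * (f0 w * \1_(E (i + k)) w).
  apply/funext => w; rewrite /h /f1 /f0 /walk_x big_ord_recr /= indicE.
  by case: (w \in _); rewrite /= ?addn1 ?addn0; ring.
have i1 := future_indep_indic h1; have i0 := future_indep_indic h0.
have h0' := future_indepW (leqnSn _) h0.
rewrite addnS; split; first by apply: future_indepD; [exact: future_indepD|exact: future_indepZ].
rewrite meanD; [|exact: (proj1 (future_indepD i1 h0'))|exact: (proj1 (future_indepZ (-1) i0))].
rewrite meanD; [|exact: (proj1 i1)|exact: (proj1 h0)].
rewrite meanZ; last exact: (proj1 i0).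
by rewrite !future_indep_mean_indic // m1 m0 /=; ring.
Qed.

Lemma mean_binom k (g : nat -> R) : mean P (fun w => g (walk_x E k w)) = binom_mean a k g.
Proof.
have [_] := mean_walk k g future_indep_cst1; rewrite mean_cst mul1r => <-.
by congr mean; apply/funext => w; rewrite mul1r.
Qed.

Lemma future_indep_walk k (g : nat -> R) : future_indep P a E k (fun w => g (walk_x E k w)).
Proof.
have [h _] := mean_walk k g future_indep_cst1; move: h.
by rewrite (_ : (fun w => _) = fun w => g (walk_x E k w)) //; apply/funext => w; rewrite mul1r.
Qed.

(** * Times at which [q] divides the walk *)

Definition hits (q m : nat) (w : T) : R := (q %| walk_x E (q * m) w)%:R.

Definition hit_prob (q m : nat) : R := binom_mean a (q * m) (fun t => (q %| t)%:R).

Lemma bounded_rv_hits q m : bounded_rv (hits q m).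
Proof. by have [] := future_indep_walk (q * m) (fun t => (q %| t)%:R). Qed.

Lemma mean_hits q m : mean P (hits q m) = hit_prob q m.
Proof. exact: mean_binom. Qed.

(* The times m at which q divides the walk at q m form a renewal process. *)
Lemma mean_hitsM q m l :
  mean P (fun w => hits q m w * hits q (m + l) w) = hit_prob q m * hit_prob q l.
Proof.
have [_] := mean_walk (q * l) (fun t => (q %| t)%:R)
  (future_indep_walk (q * m) (fun t => (q %| t)%:R)).
rewrite (mean_binom (q * m) (fun t => (q %| t)%:R)) => <-; congr mean; apply/funext => w.
rewrite /hits mulnDr walk_xD; case: (boolP (q %| walk_x E (q * m) w)%N) => h; rewrite ?mul0r //.
by rewrite dvdn_addr.
Qed.

Lemma hits01 q m w : 0 <= hits q m w <= 1.
Proof. by rewrite /hits; case: (_ %| _)%N; rewrite ?lexx ?ler01. Qed.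

Context (a01 : 0 < a < 1).

(** The inverse standard deviation of one step. *)
Let C : R := (Num.sqrt (a * (1 - a)))^-1.

Let C0 : 0 < C.
Proof. by have /andP[a0 a1] := a01; rewrite invr_gt0 sqrtr_gt0 mulr_gt0 // subr_gt0. Qed.

Lemma hit_prob01 q m : 0 <= hit_prob q m <= 1.
Proof.
rewrite -mean_hits -[X in _ <= _ <= X](mean_cst P 1) -[X in X <= _](mean_cst P 0).
by apply/andP; split; apply: le_mean; do ?[exact: bounded_rv_cst|exact: bounded_rv_hits];
  move=> w; case/andP: (hits01 q m w).
Qed.

(** The root of [q] comes from the [q * m] steps made. Large divisors need it; the covariance bound
    drops it. *)
Lemma hit_prob_near q m : (0 < q)%N -> (0 < m)%N ->
  `|hit_prob q m - q%:R^-1| <= C / (Num.sqrt q%:R * Num.sqrt m%:R).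
Proof.
move=> q0 m0; apply: le_trans (binom_mean_dvdn _ a01 q0) _.
have /andP[a0 a1] := a01; have v0 : 0 < a * (1 - a) by rewrite mulr_gt0 // subr_gt0.
rewrite /C -invfM -!sqrtrM ?ler0n ?(ltW v0) //.
rewrite lef_pV2 ?posrE ?sqrtr_gt0 ?mulr_gt0 ?ltr0n ?subr_gt0 // ler_wsqrtr //.
by rewrite mulrC ler_pM2r // -natrM ler_nat.
Qed.

Lemma hit_prob_near_sqrt q m : (0 < q)%N -> (0 < m)%N ->
  `|hit_prob q m - q%:R^-1| <= C / Num.sqrt m%:R.
Proof.
move=> q0 m0; apply: le_trans (hit_prob_near q0 m0) _.
rewrite ler_pM2l // lef_pV2 ?posrE ?mulr_gt0 ?sqrtr_gt0 ?ltr0n //.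
by rewrite ler_peMl ?sqrtr_ge0 // -[leLHS]sqrtr1 ler_wsqrtr // ler1n.
Qed.

Let inv01 (q : nat) : (0 < q)%N -> 0 <= (q%:R^-1 : R) <= 1.
Proof. by move=> q0; rewrite invr_ge0 ler0n invf_le1 ?ltr0n // ler1n. Qed.

(** Centred at the limit [q%:R^-1] instead of the mean, so that sums measure the distance to the
    main term. *)
Let dev q m w := hits q m w - q%:R^-1.

Let bounded_dev q m : bounded_rv (dev q m).
Proof. by apply: bounded_rvD; [exact: bounded_rv_hits|exact: bounded_rv_cst]. Qed.

(** Writing h for [hit_prob q] and p for 1/q, the renewal identity turns the mean into h(m) (h(l) -
    p) - p (h(m+l) - p), two terms of size at most C / sqrt l. *)
Lemma mean_devM q m l : (0 < q)%N -> (0 < m)%N -> (0 < l)%N ->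
  mean P (fun w => dev q m w * dev q (m + l) w) <= 2 * C / Num.sqrt l%:R.
Proof.
move=> q0 m0 l0; set p : R := q%:R^-1.
have -> : (fun w => dev q m w * dev q (m + l) w) =
    (fun w => (hits q m w * hits q (m + l) w + (- p) * hits q m w) +
      ((- p) * hits q (m + l) w + p ^+ 2)).
  by apply/funext => w; rewrite /dev -/p; ring.
have bm := bounded_rv_hits q m; have bl := bounded_rv_hits q (m + l).
rewrite meanD; first last.
- by apply: bounded_rvD; [exact: bounded_rvZ|exact: bounded_rv_cst].
- by apply: bounded_rvD; [exact: bounded_rvM|exact: bounded_rvZ].
rewrite meanD; [|exact: bounded_rvM|exact: bounded_rvZ].
rewrite meanD; [|exact: bounded_rvZ|exact: bounded_rv_cst].
rewrite mean_cst !meanZ // mean_hitsM !mean_hits.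
have pm := hit_prob01 q m.
have p01 : 0 <= p <= 1 := inv01 q0.
have hl := hit_prob_near_sqrt q0 l0.
have ml0 : (0 < m + l)%N by rewrite addn_gt0 m0.
have hml : `|hit_prob q (m + l) - p| <= C / Num.sqrt l%:R.
  apply: le_trans (hit_prob_near_sqrt q0 ml0) _.
  by rewrite ler_pM2l // lef_pV2 ?posrE ?sqrtr_gt0 ?ltr0n // ler_wsqrtr // ler_nat leq_addl.
move: hl hml pm p01; rewrite -mulrA -/p; move: (hit_prob _ _) (hit_prob _ _) (hit_prob _ _) (C / _).
move=> x y z e; rewrite !ler_norml; nra.
Qed.

(** Passing from [M] to [M.+1] adds a square at most 1 and twice the covariances, which total at
    most 4 C sqrt M. *)
Lemma mean_sum_dev_sqr q M : (0 < q)%N ->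
  mean P (fun w => (\sum_(1 <= m < M.+1) dev q m w) ^+ 2) <=
  M%:R * (1 + 8 * C * Num.sqrt M%:R).
Proof.
move=> q0; elim: M => [|M IH].
  rewrite mul0r (_ : (fun w => _) = fun=> 0) ?mean_cst //.
  by apply/funext => w; rewrite big_geq // expr0n.
have bS : bounded_rv (fun w => \sum_(1 <= m < M.+1) dev q m w) by exact: bounded_rv_sum.
have -> : (fun w => (\sum_(1 <= m < M.+2) dev q m w) ^+ 2) =
  (fun w => ((\sum_(1 <= m < M.+1) dev q m w) ^+ 2 + dev q M.+1 w ^+ 2) +
     2 * \sum_(1 <= m < M.+1) dev q m w * dev q M.+1 w).
  apply/funext => w; rewrite big_nat_recr //= -mulr_suml.
  by move: (\sum_(_ <= _ < _) _) (dev _ _ _) => x y; ring.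
have bM m : bounded_rv (fun w => dev q m w * dev q M.+1 w) by exact: bounded_rvM.
rewrite meanD; first last.
- by apply: bounded_rvZ; exact: bounded_rv_sum.
- by apply: bounded_rvD; exact: bounded_rvM.
rewrite meanD; [|exact: bounded_rvM|exact: bounded_rvM].
rewrite meanZ; last exact: bounded_rv_sum.
rewrite mean_sum //.
have z2 : mean P (fun w => dev q M.+1 w ^+ 2) <= 1.
  rewrite -[leRHS](mean_cst P 1); apply: le_mean; [exact: bounded_rvM|exact: bounded_rv_cst|].
  move=> w; have := hits01 q M.+1 w; rewrite /dev.
  have := inv01 q0.
  by move: (hits _ _ _) (_^-1) => x y; nra.
have cov : \sum_(1 <= m < M.+1) mean P (fun w => dev q m w * dev q M.+1 w) <=
    4 * C * Num.sqrt M%:R.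
  apply: (@le_trans _ _ (2 * C * \sum_(1 <= m < M.+1) (Num.sqrt m%:R)^-1)); last first.
    rewrite (_ : 4 * C * _ = 2 * C * (2 * Num.sqrt M%:R)); last ring.
    by rewrite ler_pM2l ?mulr_gt0 //; exact: sum_inv_sqrt.
  (* Reversal makes the gap [M.+1 - m] the summation index. *)
  rewrite mulr_sumr [leRHS]big_nat_rev /=; apply: ler_sum_nat => m /andP[m0 mM].
  rewrite add1n subSS -{1}[M.+1](subnKC (ltnW mM)).
  by apply: mean_devM; rewrite ?subn_gt0.
have sM : Num.sqrt M%:R <= Num.sqrt M.+1%:R :> R by rewrite ler_wsqrtr // ler_nat.
have s0 : 0 <= Num.sqrt M%:R :> R by rewrite sqrtr_ge0.
have M0 : 0 <= M%:R :> R by rewrite ler0n.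
move: IH z2 cov sM s0; move: (mean _ _) (mean _ _) (\sum_(_ <= _ < _) _) => x y z.
move: (Num.sqrt M%:R) (Num.sqrt M.+1%:R) => s t IH z2 cov st s0; rewrite -[M.+1%:R]natr1.
have h1 : C * s <= C * t by rewrite ler_pM2l.
have h2 : M%:R * (C * s) <= M%:R * (C * t) by rewrite ler_wpM2l.
lra.
Qed.

(** * Mean error along sixteenth powers *)

Definition hit_count (q n : nat) (w : T) : R := \sum_(1 <= m < (n %/ q).+1) hits q m w.

Lemma bounded_hit_count q n : bounded_rv (hit_count q n).
Proof. by apply: bounded_rv_sum => m; exact: bounded_rv_hits. Qed.

(** At most k^16 summands give a second moment O(k^24), hence [mean_norm_le] with s = k^12.
    Replacing [M / q] by n / q^2 costs at most 1. *)
Lemma mean_hit_count_dist q k : (0 < q)%N -> (0 < k)%N ->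
  mean P (fun w => `|hit_count q (k ^ 16) w - (k ^ 16)%N%:R / q%:R ^+ 2|) <=
  (2 + 4 * C) * k%:R ^+ 12.
Proof.
move=> q0 k0; set n := (k ^ 16)%N; set M := (n %/ q)%N.
have q0' : 0 < q%:R :> R by rewrite ltr0n.
have k1 : 1 <= k%:R :> R by rewrite ler1n.
have bS : bounded_rv (fun w => \sum_(1 <= m < M.+1) dev q m w) by exact: bounded_rv_sum.
have nk : n%:R = k%:R ^+ 16 :> R by rewrite /n natrX.
have Mn : M%:R <= k%:R ^+ 16 :> R by rewrite -nk ler_nat leq_div.
have sMn : Num.sqrt M%:R <= k%:R ^+ 8 :> R.
  rewrite -[leRHS]ger0_norm ?exprn_ge0 ?ler0n // -sqrtr_sqr ler_wsqrtr //.
  by rewrite -exprM.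
have var : mean P (fun w => (\sum_(1 <= m < M.+1) dev q m w) ^+ 2) <=
    (1 + 8 * C) * k%:R ^+ 24.
  apply: le_trans (mean_sum_dev_sqr _ q0) _.
  apply: (@le_trans _ _ (k%:R ^+ 16 * (1 + 8 * C * k%:R ^+ 8))).
    rewrite ler_pM ?ler0n // ?addr_ge0 ?mulr_ge0 ?sqrtr_ge0 ?(ltW C0) //.
    by rewrite lerD2l ler_pM2l ?mulr_gt0.
  have -> : (1 + 8 * C) * k%:R ^+ 24 = k%:R ^+ 16 * (k%:R ^+ 8 + 8 * C * k%:R ^+ 8) by ring.
  by rewrite ler_pM2l ?exprn_gt0 ?ltr0n // lerD2r exprn_ege1.
have k12 : 0 < k%:R ^+ 12 :> R by rewrite exprn_gt0 ?ltr0n.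
have meanS := mean_norm_le k12 bS var.
apply: (@le_trans _ _ (mean P (fun w => `|\sum_(1 <= m < M.+1) dev q m w| + 1))).
  apply: le_mean.
  - apply: bounded_rv_norm; apply: bounded_rvD; first exact: bounded_hit_count.
    exact: bounded_rv_cst.
  - by apply: bounded_rvD; [exact: bounded_rv_norm|exact: bounded_rv_cst].
  move=> w; have -> : hit_count q n w - n%:R / q%:R ^+ 2 =
      \sum_(1 <= m < M.+1) dev q m w + (M%:R / q%:R - n%:R / q%:R ^+ 2).
    rewrite /dev sumrB sumr_const_nat subn1 /= -[_ *+ M]mulr_natl /hit_count -/M.
    by rewrite addrA subrK.
  apply: le_trans (ler_normD _ _) _; rewrite lerD2l.
  have -> : M%:R / q%:R - n%:R / q%:R ^+ 2 = (M%:R * q%:R - n%:R) / q%:R ^+ 2 :> R.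
    by field; rewrite gt_eqF.
  rewrite normrM normfV [`|q%:R ^+ 2|]ger0_norm ?exprn_ge0 ?ler0n // ler_pdivrMr ?exprn_gt0 // mul1r.
  have q1 : 1 <= q%:R :> R by rewrite ler1n.
  have h1 : M%:R * q%:R <= n%:R :> R by rewrite -natrM ler_nat leq_divM.
  have h2 : n%:R <= M%:R * q%:R + q%:R :> R.
    by rewrite -natrM -natrD ler_nat; have := ltn_ceil n q0; rewrite -/M mulSn addnC; exact: ltnW.
  rewrite ler_norml; nra.
rewrite meanD; [|exact: bounded_rv_norm|exact: bounded_rv_cst].
rewrite mean_cst; move: meanS.
have -> : (1 + 8 * C) * k%:R ^+ 24 / k%:R ^+ 12 = (1 + 8 * C) * k%:R ^+ 12 :> R.
  by field; rewrite pnatr_eq0 -lt0n.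
have : 1 <= k%:R ^+ 12 :> R by rewrite exprn_ege1.
lra.
Qed.

(** Summing [hit_prob_near] over [m <= n / q] gives (C / sqrt q) times 2 sqrt(n / q) as the second
    term. *)
Lemma mean_hit_count_le q n : (0 < q)%N ->
  mean P (hit_count q n) <= n%:R / q%:R ^+ 2 + 2 * C * Num.sqrt n%:R / q%:R.
Proof.
move=> q0; have q0' : 0 < q%:R :> R by rewrite ltr0n.
set M := (n %/ q)%N.
rewrite /hit_count mean_sum; last by move=> m; exact: bounded_rv_hits.
apply: (@le_trans _ _ (\sum_(1 <= m < M.+1) (q%:R^-1 + C / Num.sqrt q%:R * (Num.sqrt m%:R)^-1))).
  apply: ler_sum_nat => m /andP[m0 _]; rewrite mean_hits -lerBlDl.
  apply: le_trans (ler_norm _) (le_trans (hit_prob_near q0 m0) _).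
  by rewrite invfM mulrA.
rewrite big_split /= sumr_const_nat subn1 /= -mulr_sumr.
have sq0 : 0 < Num.sqrt q%:R :> R by rewrite sqrtr_gt0.
have h1 : M%:R <= n%:R / q%:R :> R by rewrite ler_pdivlMr // -natrM ler_nat leq_divM.
apply: lerD.
  by rewrite -[_ *+ M]mulr_natl expr2 invfM mulrA ler_pM2r // invr_gt0.
apply: (@le_trans _ _ (C / Num.sqrt q%:R * (2 * Num.sqrt M%:R))).
  by rewrite ler_pM2l ?divr_gt0 //; exact: sum_inv_sqrt.
apply: (@le_trans _ _ (C / Num.sqrt q%:R * (2 * (Num.sqrt n%:R / Num.sqrt q%:R)))).
  rewrite ler_pM2l ?divr_gt0 // ler_pM2l //.
  by rewrite -sqrtrV ?ler0n // -sqrtrM ?ler0n // ler_wsqrtr.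
rewrite -[X in _ <= _ / X](sqr_sqrtr (ler0n _ q)) le_eqVlt; apply/orP; left; apply/eqP.
by field; rewrite gt_eqF.
Qed.

(* The random error at time n = k^16, with small divisors being those up to k^2: these exponents
   make its mean O(k^-2), hence summable. *)
Definition error (k : nat) (w : T) : R :=
  (k%:R ^+ 16)^-1 *
  (\sum_(1 <= q < (k ^ 2).+1) `|hit_count q (k ^ 16) w - (k ^ 16)%N%:R / q%:R ^+ 2| +
   \sum_((k ^ 2).+1 <= q < (k ^ 16).+1) hit_count q (k ^ 16) w).

Lemma bounded_error k : bounded_rv (error k).
Proof.
apply: bounded_rvZ; apply: bounded_rvD; apply: bounded_rv_sum => q; last exact: bounded_hit_count.
by apply/bounded_rv_norm/bounded_rvD; [exact: bounded_hit_count|exact: bounded_rv_cst].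
Qed.

Lemma error_ge0 k w : 0 <= error k w.
Proof.
rewrite mulr_ge0 ?invr_ge0 ?exprn_ge0 ?ler0n // addr_ge0 // sumr_ge0 // => q _.
by apply: sumr_ge0 => m _; case/andP: (hits01 q m w).
Qed.

(** Small divisors give k^2 terms of order k^12. Large ones give k^16 times the zeta(2) tail 1 /
    k^2, plus k^8 times a harmonic sum. All is O(k^14), to be divided by k^16. *)
Lemma mean_error k : (0 < k)%N -> mean P (error k) <= (3 + 38 * C) / k%:R ^+ 2.
Proof.
move=> k0; have k1 : 1 <= k%:R :> R by rewrite ler1n.
have k0' : 0 < k%:R :> R by rewrite ltr0n.
set n := (k ^ 16)%N; have nk : n%:R = k%:R ^+ 16 :> R by rewrite /n natrX.
have bd q : bounded_rv (fun w => `|hit_count q n w - n%:R / q%:R ^+ 2|).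
  by apply/bounded_rv_norm/bounded_rvD; [exact: bounded_hit_count|exact: bounded_rv_cst].
rewrite /error meanZ; last first.
  by apply: bounded_rvD; apply: bounded_rv_sum => // q; exact: bounded_hit_count.
rewrite meanD; [|exact: bounded_rv_sum|by apply: bounded_rv_sum => q; exact: bounded_hit_count].
rewrite (mean_sum P _ _ bd) (mean_sum P _ _ (fun q => bounded_hit_count q n)).
have small : \sum_(1 <= q < (k ^ 2).+1) mean P (fun w => `|hit_count q n w - n%:R / q%:R ^+ 2|) <=
    (2 + 4 * C) * k%:R ^+ 14.
  apply: (@le_trans _ _ (\sum_(1 <= q < (k ^ 2).+1) (2 + 4 * C) * k%:R ^+ 12)).
    by apply: ler_sum_nat => q /andP[q0 _]; exact: mean_hit_count_dist.
  rewrite sumr_const_nat subn1 /= -[_ *+ (k ^ 2)]mulr_natl natrX le_eqVlt.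
  by apply/orP; left; apply/eqP; ring.
have k2n : (k ^ 2 <= n)%N by rewrite leq_pexp2l.
have large : \sum_((k ^ 2).+1 <= q < n.+1) mean P (hit_count q n) <=
    (1 + 34 * C) * k%:R ^+ 14.
  apply: (@le_trans _ _ (\sum_((k ^ 2).+1 <= q < n.+1)
      (n%:R * q%:R^-2 + 2 * C * Num.sqrt n%:R * q%:R^-1))).
    apply: ler_sum_nat => q /andP[kq _]; apply: mean_hit_count_le.
    exact: leq_trans kq.
  rewrite big_split /= -!mulr_sumr.
  have z : \sum_((k ^ 2).+1 <= q < n.+1) q%:R^-2 <= k%:R^-2 :> R.
    have k20 : (0 < k ^ 2 <= n)%N by rewrite expn_gt0 k0.
    have := zeta2_tail R k20; rewrite /zeta2 [X in X <= _](big_cat_nat (n := (k ^ 2).+1)) //=.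
    by rewrite lerD2l natrX.
  (* The crude ln k < k suffices, since this part only reaches order k^9: 1 + 16 ln k <= 17 k. *)
  have h : \sum_((k ^ 2).+1 <= q < n.+1) q%:R^-1 <= 17 * k%:R :> R.
    apply: (@le_trans _ _ (\sum_(1 <= q < n.+1) q%:R^-1)).
      rewrite [leRHS](big_cat_nat (n := (k ^ 2).+1)) //= lerDr.
      by apply: sumr_ge0 => q _; rewrite invr_ge0 ler0n.
    have n0 : (0 < n)%N by rewrite expn_gt0 k0.
    apply: le_trans (harmonic_le_ln R n0) _.
    rewrite nk lnXn // -[_ *+ 16]mulr_natl; have := ln_sublinear k0'; lra.
  have sn : Num.sqrt n%:R = k%:R ^+ 8 :> R.
    by rewrite nk (exprM _ 8 2) sqrtr_sqr ger0_norm ?exprn_ge0 ?ler0n.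
  have -> : (1 + 34 * C) * k%:R ^+ 14 = k%:R ^+ 14 + 34 * C * k%:R ^+ 14 by ring.
  rewrite sn nk; apply: lerD.
    apply: (@le_trans _ _ (k%:R ^+ 16 * k%:R^-2)).
      by rewrite ler_pM2l ?exprn_gt0.
    by rewrite le_eqVlt; apply/orP; left; apply/eqP; field; rewrite gt_eqF.
  apply: (@le_trans _ _ (2 * C * k%:R ^+ 8 * (17 * k%:R))).
    by rewrite ler_pM2l ?mulr_gt0 ?exprn_gt0.
  have -> : 2 * C * k%:R ^+ 8 * (17 * k%:R) = 34 * C * k%:R ^+ 9 by ring.
  by rewrite ler_pM2l ?mulr_gt0 // ler_weXn2l.
have -> : (3 + 38 * C) / k%:R ^+ 2 = (k%:R ^+ 16)^-1 *
    ((2 + 4 * C) * k%:R ^+ 14 + (1 + 34 * C) * k%:R ^+ 14).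
  by field; rewrite gt_eqF.
by rewrite ler_pM2l ?invr_gt0 ?exprn_gt0 // lerD.
Qed.

End Walk.

(** * Conclusion *)

(** For small [q] the main terms assemble into the truncated Möbius series; for large [q] the whole
    count is treated as error. The bound |mobius| <= 1 does the rest. *)
Lemma Sbar_error d (T : measurableType d) (R : realType) (E : nat -> set T) k w :
  (0 < k)%N ->
  `|Sbar E (k ^ 16) w - 6 / pi ^+ 2| <= error R E k w +
    `|\sum_(1 <= q < (k ^ 2).+1) mobius q / q%:R ^+ 2 - 6 / pi ^+ 2| :> R.
Proof.
move=> k0; set n := (k ^ 16)%N; have n0 : 0 < n%:R :> R by rewrite ltr0n expn_gt0 k0.
have kn : (k ^ 2 <= n)%N by rewrite leq_pexp2l.
rewrite /Sbar sum_Xvis (big_cat_nat (n := (k ^ 2).+1)) //=.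
rewrite [X in _ <= X + _]/error -natrX -/n.
set A := \sum_(1 <= q < (k ^ 2).+1) mobius q / q%:R ^+ 2.
have -> : \sum_(1 <= q < (k ^ 2).+1) mobius q *
      \sum_(1 <= m < (n %/ q).+1) (q %| walk_x E (q * m) w)%:R =
    \sum_(1 <= q < (k ^ 2).+1) mobius q * (hit_count R E q n w - n%:R / q%:R ^+ 2) + n%:R * A.
  rewrite /A mulr_sumr -big_split /=; apply: eq_bigr => q _.
  by rewrite mulrBr mulrCA subrK.
set u := \sum_(1 <= q < _) mobius q * _; set v := \sum_((k ^ 2).+1 <= q < _) mobius q * _.
have -> : (u + n%:R * A + v) / n%:R - 6 / pi ^+ 2 = n%:R^-1 * (u + v) + (A - 6 / pi ^+ 2).
  by rewrite -addrA (addrC (n%:R * A)) addrA mulrDl (mulrC n%:R A) mulfK ?gt_eqF // mulrC addrA.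
apply: le_trans (ler_normD _ _) _; rewrite lerD2r normrM gtr0_norm ?invr_gt0 //.
rewrite ler_pM2l ?invr_gt0 //; apply: le_trans (ler_normD _ _) _; apply: lerD.
  apply: le_trans (ler_norm_sum _ _ _) _; apply: ler_sum => q _.
  by rewrite normrM ler_piMl // normr_mobius.
apply: le_trans (ler_norm_sum _ _ _) _; apply: ler_sum => q _.
rewrite normrM -[leRHS]mul1r ler_pM ?normr_mobius // ger0_norm //.
by apply: sumr_ge0 => m _; rewrite ler0n.
Qed.

Unset Implicit Arguments.

Theorem theorem1 (R : realType) (alpha : R) (d : measure_display)
  (T : measurableType d) (P : probability T R) (E : nat -> set T) :
  0 < alpha < 1 ->
  (forall i, measurable (E i)) ->
  (forall i, P (E i) = alpha%:E) ->
  mutually_independent P E ->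
  {ae P, forall w, (fun n => Sbar E n w : R) @ \oo --> (6 / pi ^+ 2 : R)}.
Proof.
move=> a01 mE PE indepE.
set C := (Num.sqrt (alpha * (1 - alpha)))^-1.
have C0 : 0 <= C by rewrite invr_ge0 sqrtr_ge0.
have err0 : {ae P, forall w, error R E k.+1 w @[k --> \oo] --> (0 : R)}.
  (* The means are at most (3 + 38 C) / (k+1)^2, and the partial sums of zeta(2) are at most 2. *)
  apply: (summable_means_cvg0 (B := (3 + 38 * C) * 2)) => [k|k w|n].
  - exact: bounded_error mE PE indepE k.+1.
  - exact: error_ge0.
  apply: (@le_trans _ _ ((3 + 38 * C) * zeta2 n)).
    rewrite /zeta2 mulr_sumr big_add1 /=; apply: ler_sum => k _.
    exact: (mean_error mE PE indepE a01).
  rewrite ler_wpM2l ?addr_ge0 ?mulr_ge0 //.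
  exact: zeta2_le2.
apply: filterS err0 => w err0; apply: cvg_Sbar_subseq.
apply: (@cvg_sub0 _ _ _ _ _ _ (fun=> 6 / pi ^+ 2)); last exact: cvg_cst.
apply: norm_cvg0.
pose A N : R := \sum_(1 <= q < N.+1) mobius q / q%:R ^+ 2.
(* The distance to the limit is squeezed by the random error plus the truncation error of the Möbius
   series at (k+1)^2. *)
apply: (@squeeze_cvgr _ _ _ _ (fun=> 0)
  (fun k => error R E k.+1 w + `|A (k.+1 ^ 2)%N - 6 / pi ^+ 2|)).
- by apply: nearW => k; rewrite normr_ge0 /=; exact: Sbar_error.
- exact: cvg_cst.
rewrite -[X in _ --> X]addr0; apply: cvgD => //.
apply/norm_cvg0P; rewrite -[X in _ --> X](subrr (6 / pi ^+ 2)).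
apply: cvgB; last exact: cvg_cst.
move=> B /cvg_mobius_series[N _ NB]; exists N => // k /= Nk; apply: NB => /=; apply: leq_trans Nk _.
by apply: leq_trans (leqnSn k) _; rewrite -{1}[k.+1]expn1 leq_pexp2l.
Qed.
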